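(* Let $\mathfrak T$ be a triangulated category, let $\mathfrak I\subseteq\mathfrak T$ be a homological ideal, and let $F\colon\mathfrak T\to\mathfrak C$ be an $\mathfrak I$-exact stable homological functor into a stable Abelian category $\mathfrak C$; let $\mathfrak P\mathfrak C$ be the class of projective objects in $\mathfrak C$, and let $F^{\vdash}$ be the partially defined left adjoint of $F$. Suppose that idempotent morphisms in $\mathfrak T$ split. The functor $F$ is the universal $\mathfrak I$-exact stable homological functor and there are enough $\mathfrak I$-projective objects in $\mathfrak T$ if and only if (1) $\mathfrak C$ has enough projective objects; (2) the adjoint functor $F^{\vdash}$ is defined on $\mathfrak P\mathfrak C$; (3) $F\circ F^{\vdash}(A)\cong A$ for all $A\in\mathfrak P\mathfrak C$.
   Context: $\mathfrak T(A,B)$ denotes the group of morphisms $A\to B$; $\Sigma$ is the suspension of $\mathfrak T$. An ideal $\mathfrak I$ in an additive category is a family of subgroups $\mathfrak I(A,B)\subseteq\mathfrak T(A,B)$ closed under composition with arbitrary morphisms on both sides. A stable Abelian category is an Abelian category with an additive automorphism $\Sigma$. A covariant additive functor $F\colon\mathfrak T\to\mathfrak C$ into an Abelian category is homological if $F(A)\to F(B)\to F(C)$ is exact at $F(B)$ for every exact triangle $A\to B\to C\to\Sigma A$; it is stable homological if moreover $\mathfrak C$ is stable and there are natural isomorphisms $F(\Sigma A)\cong\Sigma F(A)$. The kernel of $F$ is the ideal $\ker F(A,B)=\{f\in\mathfrak T(A,B)\mid F(f)=0\}$. A homological ideal is an ideal that is the kernel of some stable homological functor. A homological functor $G$ on $\mathfrak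 T$ is $\mathfrak I$-exact if $G(f)=0$ for all $f\in\mathfrak I$, that is, $\mathfrak I\subseteq\ker G$. An object $A$ of $\mathfrak T$ is $\mathfrak I$-projective if $\mathfrak T(A,\cdot)\colon\mathfrak T\to\mathfrak{Ab}$ (Abelian groups) is $\mathfrak I$-exact. A morphism $f\colon A\to B$, embedded in an exact triangle $A\xrightarrow{f}B\xrightarrow{g}C\xrightarrow{h}\Sigma A$, is $\mathfrak I$-epic if $g\in\mathfrak I$. There are enough $\mathfrak I$-projective objects if for each $A\in\mathfrak T$ there is an $\mathfrak I$-epic morphism $P\to A$ with $P$ $\mathfrak I$-projective. An $\mathfrak I$-exact stable homological functor $F\colon\mathfrak T\to\mathfrak C$ is universal if any other $\mathfrak I$-exact stable homological functor $G\colon\mathfrak T\to\mathfrak C'$ (into a stable Abelian category) factors as $G=\bar G\circ F$ for a stable exact functor $\bar G\colon\mathfrak C\to\mathfrak C'$ that is unique up to natural isomorphism. Partially defined left adjoint: for $A\in\mathfrak C$, $F^{\vdash}(A)$ is defined if the functor $B\mapsto\mathfrak C(A,F(B))$ on $\mathfrak T$ is representable, and then $F^{\vdash}(A)\in\mathfrak T$ is the representing object, so that $\mathfrak T(F^{\vdash}(A),B)\cong\mathfrak C(A,F(B))$ naturally in $B$. This gives a functor from the full subcategory of all such $A$ to $\mathfrak T$.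
   Formalization: The condition ker F ⊆ I is added to (1)–(3), since the ''if'' part fails for F = 0 into the zero category; it is proved necessary in the ''only if'' part. The isomorphism in (3) is taken natural in A, and G = Ḡ∘F holds up to natural isomorphism. *)

(* Defs.v *)
From HB Require Import structures.
From mathcomp Require Import all_boot all_algebra.
From mathcomp Require Import boolp.

Set Implicit Arguments.
Unset Strict Implicit.
Unset Printing Implicit Defensive.

Import GRing.Theory.
Local Open Scope ring_scope.

Reserved Notation "g ∘ f" (at level 40, left associativity).

(* All categories below are preadditive (hom sets are abelian groups) and all
   functors are additive; additive, abelian and triangulated categories are
   obtained by adding structure. *)
Record category := Category {
  obj :> Type;
  mor : obj -> obj -> zmodType;
  idm : forall A, mor A A;
  mcomp : forall A B C, mor B C -> mor A B -> mor A C;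
  mcompA : forall A B C D (h : mor C D) (g : mor B C) (f : mor A B),
    mcomp h (mcomp g f) = mcomp (mcomp h g) f;
  mcomp1m : forall A B (f : mor A B), mcomp (idm B) f = f;
  mcompm1 : forall A B (f : mor A B), mcomp f (idm A) = f;
  mcompDl : forall A B C (g g' : mor B C) (f : mor A B),
    mcomp (g + g') f = mcomp g f + mcomp g' f;
  mcompDr : forall A B C (g : mor B C) (f f' : mor A B),
    mcomp g (f + f') = mcomp g f + mcomp g f' }.

Arguments idm {c} A.
Notation "g ∘ f" := (mcomp g f) : ring_scope.

Definition is_iso (C : category) (A B : C) (f : mor A B) : Prop :=
  exists g : mor B A, g ∘ f = idm A /\ f ∘ g = idm B.

Definition is_mono (C : category) (A B : C) (f : mor A B) : Prop :=
  forall (X : C) (x y : mor X A), f ∘ x = f ∘ y -> x = y.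

Definition is_epi (C : category) (A B : C) (f : mor A B) : Prop :=
  forall (X : C) (x y : mor B X), x ∘ f = y ∘ f -> x = y.

Definition idempotents_split (C : category) : Prop :=
  forall (A : C) (e : mor A A), e ∘ e = e ->
  exists (B : C) (r : mor A B) (s : mor B A), r ∘ s = idm B /\ s ∘ r = e.

(** Functors and natural isomorphisms *)

Record functor (C D : category) := Functor {
  fobj :> C -> D;
  fmap : forall A B : C, mor A B -> mor (fobj A) (fobj B);
  fmap1 : forall A : C, fmap (idm A) = idm (fobj A);
  fmapM : forall (A B E : C) (g : mor B E) (f : mor A B),
    fmap (g ∘ f) = fmap g ∘ fmap f;
  fmapD : forall (A B : C) (f g : mor A B), fmap (f + g) = fmap f + fmap g }.

Arguments fmap {C D} f {A B} _ : rename.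

Section FunctorComposition.
Variables (C D E : category) (G : functor D E) (F : functor C D).

Lemma fcomp1 (A : C) : fmap G (fmap F (idm A)) = idm (G (F A)).
Proof. by rewrite !fmap1. Qed.

Lemma fcompM (A B X : C) (g : mor B X) (f : mor A B) :
  fmap G (fmap F (g ∘ f)) = fmap G (fmap F g) ∘ fmap G (fmap F f).
Proof. by rewrite !fmapM. Qed.

Lemma fcompD (A B : C) (f g : mor A B) :
  fmap G (fmap F (f + g)) = fmap G (fmap F f) + fmap G (fmap F g).
Proof. by rewrite !fmapD. Qed.

Definition fcomp : functor C E :=
  @Functor C E (fun A => G (F A)) (fun A B f => fmap G (fmap F f))
    fcomp1 fcompM fcompD.
End FunctorComposition.

Definition nat_iso (C D : category) (F G : functor C D) : Prop :=
  exists eta : forall A : C, mor (F A) (G A),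
    (forall A, is_iso (eta A)) /\
    (forall (A B : C) (f : mor A B), eta B ∘ fmap F f = fmap G f ∘ eta A).

(** Full subcategories *)

Definition full_sub (C : category) (P : C -> Prop) : category :=
  @Category {A : C | P A} (fun A B => mor (sval A) (sval B))
    (fun A => idm (sval A)) (fun A B D g f => g ∘ f)
    (fun A B D E h g f => mcompA h g f)
    (fun A B f => mcomp1m f) (fun A B f => mcompm1 f)
    (fun A B D g g' f => mcompDl g g' f) (fun A B D g f f' => mcompDr g f f').

Definition full_incl (C : category) (P : C -> Prop) : functor (full_sub P) C :=
  @Functor (full_sub P) C (fun A => sval A) (fun A B f => f)
    (fun A => erefl) (fun A B E g f => erefl) (fun A B f g => erefl).

Definition full_sub_incl (C : category) (P Q : C -> Prop)
    (PQ : forall A, P A -> Q A) : functor (full_sub P) (full_sub Q) :=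
  @Functor (full_sub P) (full_sub Q)
    (fun A => exist _ (sval A) (PQ _ (svalP A))) (fun A B f => f)
    (fun A => erefl) (fun A B E g f => erefl) (fun A B f g => erefl).

(** Additive and abelian categories *)

Definition is_zero_obj (C : category) (Z : C) : Prop :=
  (forall (A : C) (f : mor A Z), f = 0) /\ (forall (A : C) (f : mor Z A), f = 0).

Definition is_biproduct (C : category) (A B S : C)
    (i1 : mor A S) (i2 : mor B S) (p1 : mor S A) (p2 : mor S B) : Prop :=
  [/\ p1 ∘ i1 = idm A, p2 ∘ i2 = idm B, p2 ∘ i1 = 0, p1 ∘ i2 = 0
    & i1 ∘ p1 + i2 ∘ p2 = idm S].

Definition is_additive (C : category) : Prop :=
  (exists Z : C, is_zero_obj Z) /\
  (forall A B : C, exists (S : C) (i1 : mor A S) (i2 : mor B S)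
     (p1 : mor S A) (p2 : mor S B), is_biproduct i1 i2 p1 p2).

Definition is_kernel (C : category) (A B K : C) (f : mor A B) (k : mor K A) :
    Prop :=
  f ∘ k = 0 /\
  (forall (X : C) (x : mor X A), f ∘ x = 0 -> exists! y : mor X K, k ∘ y = x).

Definition is_cokernel (C : category) (A B Q : C) (f : mor A B) (q : mor B Q) :
    Prop :=
  q ∘ f = 0 /\
  (forall (X : C) (x : mor B X), x ∘ f = 0 -> exists! y : mor Q X, y ∘ q = x).

Definition is_abelian (C : category) : Prop :=
  [/\ is_additive C,
      forall (A B : C) (f : mor A B), exists (K : C) (k : mor K A), is_kernel f k,
      forall (A B : C) (f : mor A B), exists (Q : C) (q : mor B Q), is_cokernel f q,
      forall (A B : C) (m : mor A B), is_mono m ->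
        exists (X : C) (f : mor B X), is_kernel f m
    & forall (A B : C) (e : mor A B), is_epi e ->
        exists (X : C) (f : mor X A), is_cokernel f e].

(* The image of f is the kernel of its cokernel. *)
Definition is_image (C : category) (A B M : C) (f : mor A B) (m : mor M B) :
    Prop :=
  exists (Q : C) (q : mor B Q), is_cokernel f q /\ is_kernel q m.

(* Exactness of A -f-> B -g-> D at B: some subobject of B is both the image
   of f and the kernel of g. *)
Definition exact_at (C : category) (A B D : C) (f : mor A B) (g : mor B D) :
    Prop :=
  exists (M : C) (m : mor M B), is_image f m /\ is_kernel g m.

Definition exact_functor (C D : category) (F : functor C D) : Prop :=
  forall (X Y Z : C) (f : mor X Y) (g : mor Y Z),
    is_kernel g f /\ is_cokernel f g ->
    is_kernel (fmap F g) (fmap F f) /\ is_cokernel (fmap F f) (fmap F g).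

Definition projective (C : category) (P : C) : Prop :=
  forall (X Y : C) (e : mor X Y) (f : mor P Y), is_epi e ->
  exists g : mor P X, e ∘ g = f.

Definition enough_projectives (C : category) : Prop :=
  forall A : C, exists (P : C) (e : mor P A), projective P /\ is_epi e.

(** Suspensions *)

(* An automorphism (not just an autoequivalence) of a category: a functor that
   is bijective on objects and on morphisms. *)
Definition is_automorphism (C : category) (S : functor C C) : Prop :=
  bijective (fobj S) /\ (forall A B : C, bijective (@fmap C C S A B)).

Record stable_additive := StableAdditive {
  stable_cat :> category;
  stable_is_additive : is_additive stable_cat;
  susp : functor stable_cat stable_cat;
  susp_aut : is_automorphism susp }.

Arguments susp {s}.

Record stable_abelian := StableAbelian {
  stable_abelian_additive :> stable_additive;
  stable_is_abelian : is_abelian stable_abelian_additive }.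

Definition stable_functor (C D : stable_additive) (F : functor C D) : Prop :=
  nat_iso (fcomp F susp) (fcomp susp F).

(** Triangulated categories *)

(* [tri f g h] : the triangle A -f-> B -g-> C -h-> susp A is exact.  The axioms
   are Verdier's TR1 (three parts), TR2, TR3 and TR4. *)
Record triangulated := Triangulated {
  triangulated_stable :> stable_additive;
  tri : forall A B C : triangulated_stable,
    mor A B -> mor B C -> mor C (susp A) -> Prop;
  tri_id : forall A Z : triangulated_stable, is_zero_obj Z ->
    tri (idm A) (0 : mor A Z) (0 : mor Z (susp A));
  tri_iso : forall (A B C A' B' C' : triangulated_stable)
      (f : mor A B) (g : mor B C) (h : mor C (susp A))
      (f' : mor A' B') (g' : mor B' C') (h' : mor C' (susp A'))
      (a : mor A A') (b : mor B B') (c : mor C C'),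
    is_iso a -> is_iso b -> is_iso c ->
    b ∘ f = f' ∘ a -> c ∘ g = g' ∘ b -> fmap susp a ∘ h = h' ∘ c ->
    tri f g h -> tri f' g' h';
  tri_cone : forall (A B : triangulated_stable) (f : mor A B),
    exists (C : triangulated_stable) (g : mor B C) (h : mor C (susp A)), tri f g h;
  tri_rot : forall (A B C : triangulated_stable)
      (f : mor A B) (g : mor B C) (h : mor C (susp A)),
    tri f g h <-> tri g h (- fmap susp f);
  tri_fill : forall (A B C A' B' C' : triangulated_stable)
      (f : mor A B) (g : mor B C) (h : mor C (susp A))
      (f' : mor A' B') (g' : mor B' C') (h' : mor C' (susp A'))
      (a : mor A A') (b : mor B B'),
    tri f g h -> tri f' g' h' -> b ∘ f = f' ∘ a ->
    exists c : mor C C', c ∘ g = g' ∘ b /\ fmap susp a ∘ h = h' ∘ c;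
  tri_oct : forall (X Y Z Z' X' Y' : triangulated_stable)
      (f : mor X Y) (g : mor Y Z)
      (i : mor Y Z') (i' : mor Z' (susp X))
      (j : mor Z X') (j' : mor X' (susp Y))
      (k : mor Z Y') (k' : mor Y' (susp X)),
    tri f i i' -> tri g j j' -> tri (g ∘ f) k k' ->
    exists (u : mor Z' Y') (v : mor Y' X'),
      tri u v (fmap susp i ∘ j') /\
      [/\ u ∘ i = k ∘ g, k' ∘ u = i', v ∘ k = j & j' ∘ v = fmap susp f ∘ k'] }.

Definition homological (T : triangulated) (C : category) (F : functor T C) :
    Prop :=
  forall (X Y Z : T) (f : mor X Y) (g : mor Y Z) (h : mor Z (susp X)),
    tri f g h -> exact_at (fmap F f) (fmap F g).

Definition stable_homological (T : triangulated) (C : stable_abelian)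
    (F : functor T C) : Prop :=
  homological F /\ stable_functor F.

(** Ideals *)

Record ideal (C : category) := Ideal {
  in_ideal :> forall A B : C, mor A B -> Prop;
  ideal0 : forall A B : C, in_ideal (0 : mor A B);
  idealB : forall (A B : C) (f g : mor A B),
    in_ideal f -> in_ideal g -> in_ideal (f - g);
  ideal_compl : forall (A B D : C) (g : mor B D) (f : mor A B),
    in_ideal f -> in_ideal (g ∘ f);
  ideal_compr : forall (A B D : C) (g : mor B D) (f : mor A B),
    in_ideal g -> in_ideal (g ∘ f) }.

Arguments in_ideal {C} i {A B} _ : rename.

Section Kernel.
Variables (C D : category) (F : functor C D).

Lemma fmap0 (A B : C) : fmap F (0 : mor A B) = 0.
Proof. by apply: (addrI (fmap F (0 : mor A B))); rewrite -fmapD !addr0. Qed.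

Lemma fmapN (A B : C) (f : mor A B) : fmap F (- f) = - fmap F f.
Proof. by apply: (addrI (fmap F f)); rewrite -fmapD !subrr fmap0. Qed.

Lemma mcomp0m (A B X : D) (f : mor A B) : (0 : mor B X) ∘ f = 0.
Proof. by apply: (addrI ((0 : mor B X) ∘ f)); rewrite -mcompDl !addr0. Qed.

Lemma mcompm0 (A B X : D) (g : mor B X) : g ∘ (0 : mor A B) = 0.
Proof. by apply: (addrI (g ∘ (0 : mor A B))); rewrite -mcompDr !addr0. Qed.

Lemma ker_idealB (A B : C) (f g : mor A B) :
  fmap F f = 0 -> fmap F g = 0 -> fmap F (f - g) = 0.
Proof. by move=> f0 g0; rewrite fmapD fmapN f0 g0 subrr. Qed.

Lemma ker_ideal_compl (A B X : C) (g : mor B X) (f : mor A B) :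
  fmap F f = 0 -> fmap F (g ∘ f) = 0.
Proof. by move=> f0; rewrite fmapM f0 mcompm0. Qed.

Lemma ker_ideal_compr (A B X : C) (g : mor B X) (f : mor A B) :
  fmap F g = 0 -> fmap F (g ∘ f) = 0.
Proof. by move=> g0; rewrite fmapM g0 mcomp0m. Qed.

Definition ker : ideal C :=
  @Ideal C (fun A B f => fmap F f = 0) fmap0 ker_idealB
    ker_ideal_compl ker_ideal_compr.
End Kernel.

Definition ideal_sub (C : category) (I J : ideal C) : Prop :=
  forall (A B : C) (f : mor A B), in_ideal I f -> in_ideal J f.

Definition homological_ideal (T : triangulated) (I : ideal T) : Prop :=
  exists (C : stable_abelian) (F : functor T C),
    stable_homological F /\ ideal_sub I (ker F) /\ ideal_sub (ker F) I.

(* Exactness is only the inclusion of I in the kernel.  The reverse inclusion is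
   a separate condition in the main theorem: it holds for universal F, but the
   conditions on projective objects do not imply it (the zero functor into the
   zero category satisfies them for every I). *)
Definition ideal_exact (T : triangulated) (I : ideal T) (C : category)
    (F : functor T C) : Prop :=
  ideal_sub I (ker F).

(* The functor mor(A, -) with values in abelian groups kills I: for f in I,
   the map induced by f is zero. *)
Definition ideal_projective (T : triangulated) (I : ideal T) (A : T) : Prop :=
  forall (X Y : T) (f : mor X Y), in_ideal I f ->
    (fun x : mor A X => f ∘ x) =1 (fun=> 0).

Definition ideal_epic (T : triangulated) (I : ideal T) (A B : T) (f : mor A B) :
    Prop :=
  exists (C : T) (g : mor B C) (h : mor C (susp A)), tri f g h /\ in_ideal I g.

Definition enough_ideal_projectives (T : triangulated) (I : ideal T) : Prop :=
  forall A : T, exists (P : T) (p : mor P A),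
    ideal_projective I P /\ ideal_epic I p.

(* A factorisation G = H F is understood up to natural isomorphism: the strict
   version is not invariant under equivalence of the target categories. *)
Definition universal (T : triangulated) (I : ideal T) (C : stable_abelian)
    (F : functor T C) : Prop :=
  [/\ stable_homological F, ideal_exact I F &
    forall (C' : stable_abelian) (G : functor T C'),
      stable_homological G -> ideal_exact I G ->
      let factors (H : functor C C') :=
        [/\ exact_functor H, stable_functor H & nat_iso (fcomp H F) G] in
      (exists H, factors H) /\
      (forall H H', factors H -> factors H' -> nat_iso H H')].

(** The partially defined left adjoint *)

Section PartialLeftAdjoint.
Variables (T C : category) (F : functor T C).

Record representation (A : C) := Representation {
  rep_obj : T;
  rep : forall B : T, {additive mor rep_obj B -> mor A (F B)};
  rep_inv : forall B : T, mor A (F B) -> mor rep_obj B;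
  repK : forall B : T, cancel (@rep B) (@rep_inv B);
  rep_invK : forall B : T, cancel (@rep_inv B) (@rep B);
  rep_nat : forall (B B' : T) (g : mor B B') (f : mor rep_obj B),
    rep B' (g ∘ f) = fmap F g ∘ rep B f }.

Definition ladj_defined (A : C) : Prop := inhabited (representation A).

Definition ladj_rep (A : full_sub ladj_defined) : representation (sval A) :=
  inhabited_witness (svalP A).

Definition ladj_obj (A : full_sub ladj_defined) : T := rep_obj (ladj_rep A).

(* The morphism corresponding to the composite of f and the unit at B. *)
Definition ladj_map (A B : full_sub ladj_defined) (f : mor A B) :
    mor (ladj_obj A) (ladj_obj B) :=
  rep_inv (ladj_rep A)
    (rep (ladj_rep B) (ladj_obj B) (idm _) ∘ (f : mor (sval A) (sval B))).

Lemma ladj_map1 (A : full_sub ladj_defined) :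
  ladj_map (idm A) = idm (ladj_obj A).
Proof. by rewrite /ladj_map mcompm1 repK. Qed.

Lemma ladj_mapM (A B D : full_sub ladj_defined) (g : mor B D) (f : mor A B) :
  ladj_map (g ∘ f) = ladj_map g ∘ ladj_map f.
Proof.
apply: (can_inj (@repK _ (ladj_rep A) _)); rewrite rep_nat /ladj_map !rep_invK.
rewrite [RHS]mcompA -(rep_nat (r := ladj_rep B)) mcompm1 rep_invK.
by rewrite -[RHS]mcompA.
Qed.

Lemma ladj_mapD (A B : full_sub ladj_defined) (f g : mor A B) :
  ladj_map (f + g) = ladj_map f + ladj_map g.
Proof.
apply: (can_inj (@repK _ (ladj_rep A) _)).
by rewrite raddfD /ladj_map !rep_invK mcompDr.
Qed.

Definition ladj : functor (full_sub ladj_defined) T :=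
  @Functor (full_sub ladj_defined) T ladj_obj ladj_map
    ladj_map1 ladj_mapM ladj_mapD.

End PartialLeftAdjoint.

(* Main.v *)
(* Call L in T adapted if F L is projective and F : mor L B -> mor (F L) (F B) is
   bijective for all B.  Since idempotents of T split, the three conditions on F
   say exactly that every object of C is a quotient of F L for an adapted L.

   If so, and if ker F = I, then every A in C is the cokernel of F d for some
   d : L1 -> L0 between adapted objects, and the extension of an I-exact functor
   G sends A to the cokernel of G d.  It is exact because a morphism
   of T that F sends to an epimorphism has its cone map in I, so G sends it to
   an epimorphism as well.

   Conversely, if there are enough I-projectives, they have weak kernels, so
   their Freyd category of finitely presented functors is abelian.  The
   restricted Yoneda functor h from T to it has kernel I and enough adapted
   objects, namely the I-projectives, so it is universal by the first part.  If
   F is universal too, then F and h agree up to an equivalence of targets, and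
   the property of having enough adapted objects passes from h to F. *)

Require Import Defs.
From HB Require Import structures.
From mathcomp Require Import all_boot all_algebra.
From mathcomp Require Import boolp.

Set Implicit Arguments.
Unset Strict Implicit.
Unset Printing Implicit Defensive.

Import GRing.Theory.
Local Open Scope ring_scope.

(** * Abelian categories *)

Section Preadditive.
Variable C : category.

(** Three points shape the details. The third condition supplies only some natural isomorphism,
    unrelated to the adjunction, whereas the bijectivity of F on morphisms out of L needs the unit
    to be invertible; a separate argument passes from the first to the second. In the other
    direction a projective A is a priori only a direct summand of some F L with L adapted: the
    idempotent cutting it out lifts to T because F is bijective on endomorphisms of L, and this is
    where splitting of idempotents enters. Finally, a suspension has to be bijective on objects, not
    merely an equivalence, so the Freyd category is built on arrows of T, which T suspends
    bijectively, rather than on functors. Its weak kernels come from desuspended cones, which need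
    not be I-projective and therefore have to be covered once more; the same covering, by adapted
    objects, recurs in the diagram chases for the extension of G. *)

Lemma mcompNl (A B D : C) (g : mor B D) (f : mor A B) : (- g) ∘ f = - (g ∘ f).
Proof. by apply: (addrI (g ∘ f)); rewrite -mcompDl !subrr mcomp0m. Qed.

Lemma mcompNr (A B D : C) (g : mor B D) (f : mor A B) : g ∘ (- f) = - (g ∘ f).
Proof. by apply: (addrI (g ∘ f)); rewrite -mcompDr !subrr mcompm0. Qed.

Lemma mcompBl (A B D : C) (g g' : mor B D) (f : mor A B) :
  (g - g') ∘ f = g ∘ f - g' ∘ f.
Proof. by rewrite mcompDl mcompNl. Qed.

Lemma mcompBr (A B D : C) (g : mor B D) (f f' : mor A B) :
  g ∘ (f - f') = g ∘ f - g ∘ f'.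
Proof. by rewrite mcompDr mcompNr. Qed.

Lemma mono_of_ker0 (A B : C) (f : mor A B) :
  (forall (X : C) (x : mor X A), f ∘ x = 0 -> x = 0) -> is_mono f.
Proof.
move=> f0 X x y fxy; apply/eqP; rewrite -subr_eq0; apply/eqP/f0.
by rewrite mcompBr fxy subrr.
Qed.

Lemma epi_of_coker0 (A B : C) (f : mor A B) :
  (forall (X : C) (x : mor B X), x ∘ f = 0 -> x = 0) -> is_epi f.
Proof.
move=> f0 X x y fxy; apply/eqP; rewrite -subr_eq0; apply/eqP/f0.
by rewrite mcompBl fxy subrr.
Qed.

Lemma mono0 (A B : C) (f : mor A B) : is_mono f ->
  forall (X : C) (x : mor X A), f ∘ x = 0 -> x = 0.
Proof. by move=> fm X x fx0; apply: fm; rewrite fx0 mcompm0. Qed.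

Lemma epi0 (A B : C) (f : mor A B) : is_epi f ->
  forall (X : C) (x : mor B X), x ∘ f = 0 -> x = 0.
Proof. by move=> fm X x fx0; apply: fm; rewrite fx0 mcomp0m. Qed.

Lemma mono_comp (A B D : C) (g : mor B D) (f : mor A B) :
  is_mono g -> is_mono f -> is_mono (g ∘ f).
Proof. by move=> gm fm X x y; rewrite -!mcompA => /gm /fm. Qed.

Lemma epi_comp (A B D : C) (g : mor B D) (f : mor A B) :
  is_epi g -> is_epi f -> is_epi (g ∘ f).
Proof. by move=> ge fe X x y; rewrite !mcompA => /fe /ge. Qed.

Lemma epi_compl (A B D : C) (g : mor B D) (f : mor A B) :
  is_epi (g ∘ f) -> is_epi g.
Proof. by move=> gfe X x y xy; apply: gfe; rewrite !mcompA xy. Qed.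

Lemma split_epi (A B : C) (f : mor A B) (s : mor B A) :
  f ∘ s = idm B -> is_epi f.
Proof.
by move=> fs X x y xy; rewrite -(mcompm1 x) -(mcompm1 y) -fs !mcompA xy.
Qed.

Lemma iso_epi (A B : C) (f : mor A B) : is_iso f -> is_epi f.
Proof. by case=> g [_ /split_epi]. Qed.

Lemma iso_comp (A B D : C) (g : mor B D) (f : mor A B) :
  is_iso g -> is_iso f -> is_iso (g ∘ f).
Proof.
move=> [g' [g'g gg']] [f' [f'f ff']]; exists (f' ∘ g'); split.
  by rewrite mcompA -(mcompA f') g'g mcompm1.
by rewrite mcompA -(mcompA g) ff' mcompm1.
Qed.

Lemma kernel_mono (A B K : C) (f : mor A B) (k : mor K A) :
  is_kernel f k -> is_mono k.
Proof.
move=> [fk0 ku] X x y kxy.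
have /ku [z [_ zu]] : f ∘ (k ∘ y) = 0 by rewrite mcompA fk0 mcomp0m.
by rewrite -(zu x kxy) (zu y).
Qed.

Lemma cokernel_epi (A B Q : C) (f : mor A B) (q : mor B Q) :
  is_cokernel f q -> is_epi q.
Proof.
move=> [qf0 qu] X x y xy.
have /qu [z [_ zu]] : (y ∘ q) ∘ f = 0 by rewrite -mcompA qf0 mcompm0.
by rewrite -(zu x xy) (zu y).
Qed.

Lemma kernelI (A B K : C) (f : mor A B) (k : mor K A) : is_mono k -> f ∘ k = 0 ->
  (forall (X : C) (x : mor X A), f ∘ x = 0 -> exists y, k ∘ y = x) ->
  is_kernel f k.
Proof.
move=> km fk0 ex; split=> // X x /ex[y kyx]; exists y; split=> // z kzx.
by apply: km; rewrite kyx kzx.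
Qed.

Lemma cokernelI (A B Q : C) (f : mor A B) (q : mor B Q) :
  is_epi q -> q ∘ f = 0 ->
  (forall (X : C) (x : mor B X), x ∘ f = 0 -> exists y, y ∘ q = x) ->
  is_cokernel f q.
Proof.
move=> qe qf0 ex; split=> // X x /ex[y yqx]; exists y; split=> // z zqx.
by apply: qe; rewrite yqx zqx.
Qed.

Lemma kernel_factor (A B K X : C) (f : mor A B) (k : mor K A) (x : mor X A) :
  is_kernel f k -> f ∘ x = 0 -> exists y, k ∘ y = x.
Proof. by move=> [_ ku] /ku[y [? _]]; exists y. Qed.

Lemma cokernel_factor (A B Q X : C) (f : mor A B) (q : mor B Q) (x : mor B X) :
  is_cokernel f q -> x ∘ f = 0 -> exists y, y ∘ q = x.
Proof. by move=> [_ qu] /qu[y [? _]]; exists y. Qed.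

Lemma cokernel_comp_epi (A B Q X : C) (f : mor A B) (e : mor X A) (q : mor B Q) :
  is_epi e -> is_cokernel f q -> is_cokernel (f ∘ e) q.
Proof.
move=> ee fq; apply: cokernelI; first exact: cokernel_epi fq.
  by rewrite mcompA fq.1 mcomp0m.
move=> Y x; rewrite mcompA => /(epi0 ee) /(cokernel_factor fq) //.
Qed.

Lemma projective_iso (A B : C) (f : mor A B) :
  is_iso f -> projective A -> projective B.
Proof.
move=> [g [gf fg]] pA X Y e y ee; have [x ex] := pA X Y e (y ∘ f) ee.
by exists (x ∘ g); rewrite mcompA ex -mcompA fg mcompm1.
Qed.

End Preadditive.

Section Abelian.
Variable C : category.
Hypothesis abC : is_abelian C.

Lemma ex_kernel (A B : C) (f : mor A B) :
  exists (K : C) (k : mor K A), is_kernel f k.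
Proof. by case: abC => _ + _ _ _; apply. Qed.

Lemma ex_cokernel (A B : C) (f : mor A B) :
  exists (Q : C) (q : mor B Q), is_cokernel f q.
Proof. by case: abC => _ _ + _ _; apply. Qed.

Lemma epi_cokernel (A B K : C) (e : mor A B) (k : mor K A) :
  is_epi e -> is_kernel e k -> is_cokernel k e.
Proof.
move=> ee ek; have [X [f fe]] : exists (X : C) (f : mor X A), is_cokernel f e.
  by case: abC => _ _ _ _; apply.
apply: cokernelI => //; first exact: ek.1.
move=> Y x xk0; apply: (cokernel_factor fe).
have [f' <-] := kernel_factor ek fe.1.
by rewrite mcompA xk0 mcomp0m.
Qed.

Lemma mono_kernel (A B Q : C) (m : mor A B) (q : mor B Q) :
  is_mono m -> is_cokernel m q -> is_kernel q m.
Proof.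
move=> mm mq; have [X [f fm]] : exists (X : C) (f : mor B X), is_kernel f m.
  by case: abC => _ _ _ + _; apply.
apply: kernelI => //; first exact: mq.1.
move=> Y x qx0; apply: (kernel_factor fm).
have [f' <-] := cokernel_factor mq fm.1.
by rewrite -mcompA qx0 mcompm0.
Qed.

(** If x kills e, then f factors through the smaller subobject m ∘ n, where n is the kernel of x.
    The cokernel of m ∘ n then factors through that of f, so m factors through m ∘ n; thus n is
    split and x = 0. *)
Lemma image_factor (A B M : C) (f : mor A B) (m : mor M B) :
  is_image f m -> exists2 e : mor A M, is_epi e & m ∘ e = f.
Proof.
move=> [Q [c [fc cm]]]; have [e mef] := kernel_factor cm fc.1.
exists e => //; apply: epi_of_coker0 => X x xe0.
have [N [n xn]] := ex_kernel x.
have mnm : is_mono (m ∘ n) := mono_comp (kernel_mono cm) (kernel_mono xn).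
have [e' nee] := kernel_factor xn xe0.
have [R [r mnr]] := ex_cokernel (m ∘ n).
have [c' c'c] : exists c', c' ∘ c = r.
  apply: (cokernel_factor fc).
  by rewrite -mef -nee (mcompA m) mcompA mnr.1 mcomp0m.
have [s mns] : exists s, (m ∘ n) ∘ s = m.
  apply: (kernel_factor (mono_kernel mnm mnr)).
  by rewrite -c'c -mcompA cm.1 mcompm0.
have ns1 : n ∘ s = idm M.
  by apply: (kernel_mono cm); rewrite mcompA mns mcompm1.
by rewrite -(mcompm1 x) -ns1 mcompA xn.1 mcomp0m.
Qed.

(** The pullback is the kernel of phi on the biproduct of A and W. Since phi is epi, it is the
    cokernel of that kernel, so a z vanishing on the pullback gives a w with w ∘ phi = z ∘ p2.
    Restricting to A shows w ∘ e = 0, hence w = 0. *)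
Lemma pullback_epi (A B W : C) (e : mor A B) (x : mor W B) : is_epi e ->
  exists (V : C) (p : mor V W) (y : mor V A), is_epi p /\ e ∘ y = x ∘ p.
Proof.
move=> ee; have [[_ bp] _ _ _ _] := abC.
have [S [i1 [i2 [p1 [p2 [p1i1 p2i2 p2i1 p1i2 S1]]]]]] := bp A W.
pose phi := e ∘ p1 - x ∘ p2.
have phi1 : phi ∘ i1 = e.
  by rewrite mcompBl -!mcompA p1i1 p2i1 mcompm0 subr0 mcompm1.
have phie : is_epi phi by apply: (@epi_compl _ _ _ _ phi i1); rewrite phi1.
have [V [k phik]] := ex_kernel phi.
exists V, (p2 ∘ k), (p1 ∘ k); split; last first.
  by apply/eqP; rewrite -subr_eq0 !mcompA -mcompBl; apply/eqP; exact: phik.1.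
apply: epi_of_coker0 => X z; rewrite mcompA => zk0.
have [w wphi] := cokernel_factor (epi_cokernel phie phik) zk0.
have w0 : w = 0.
  by apply: (epi0 ee); rewrite -phi1 mcompA wphi -mcompA p2i1 mcompm0.
by rewrite -(mcompm1 z) -p2i2 mcompA -wphi w0 !mcomp0m.
Qed.

Lemma exact_at_comp0 (A B D : C) (f : mor A B) (g : mor B D) :
  exact_at f g -> g ∘ f = 0.
Proof.
move=> [M [m [fm gm]]]; have [e _ <-] := image_factor fm.
by rewrite mcompA gm.1 mcomp0m.
Qed.

(* Exactness tested on generalized elements: morphisms into the middle object,
   up to passing to an epimorphic cover of their source. *)
Lemma exact_at_cover (A B D W : C) (f : mor A B) (g : mor B D) (x : mor W B) :
  exact_at f g -> g ∘ x = 0 ->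
  exists (V : C) (p : mor V W) (y : mor V A), is_epi p /\ f ∘ y = x ∘ p.
Proof.
move=> [M [m [fm gm]]] gx0; have [e ee <-] := image_factor fm.
have [x' <-] := kernel_factor gm gx0.
have [V [p [y [pe ey]]]] := pullback_epi x' ee.
by exists V, p, y; split=> //; rewrite -!mcompA ey.
Qed.

(** The converse of [exact_at_cover]; the two together replace element chases. *)
Lemma exact_atI (A B D : C) (f : mor A B) (g : mor B D) : g ∘ f = 0 ->
  (forall (W : C) (x : mor W B), g ∘ x = 0 ->
     exists (V : C) (p : mor V W) (y : mor V A), is_epi p /\ f ∘ y = x ∘ p) ->
  exact_at f g.
Proof.
move=> gf0 ex; have [Q [c fc]] := ex_cokernel f.
have [M [m cm]] := ex_kernel c.
have fm : is_image f m by exists Q, c.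
exists M, m; split=> //; have [e ee mef] := image_factor fm.
apply: kernelI; first exact: kernel_mono cm.
  by apply: (epi0 ee); rewrite -mcompA mef.
move=> X x /ex[V [p [y [pe fy]]]]; apply: (kernel_factor cm).
by apply: (epi0 pe); rewrite -mcompA -fy mcompA fc.1 mcomp0m.
Qed.

Lemma exact_at_projective (A B D P : C) (f : mor A B) (g : mor B D)
    (x : mor P B) : projective P -> exact_at f g -> g ∘ x = 0 ->
  exists y : mor P A, f ∘ y = x.
Proof.
move=> pP [M [m [fm gm]]] gx0; have [e ee <-] := image_factor fm.
have [x' <-] := kernel_factor gm gx0.
by have [y <-] := pP _ _ _ x' ee; exists y; rewrite mcompA.
Qed.

Lemma cokernel_exact (A B D : C) (f : mor A B) (g : mor B D) :
  is_cokernel f g -> exact_at f g.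
Proof.
move=> fg; have [M [m gm]] := ex_kernel g.
by exists M, m; split=> //; exists D, g.
Qed.

Lemma exact_cokernel (A B D : C) (f : mor A B) (g : mor B D) :
  is_epi g -> exact_at f g -> is_cokernel f g.
Proof.
move=> ge [M [m [fm gm]]]; have [e ee <-] := image_factor fm.
by apply: cokernel_comp_epi => //; apply: epi_cokernel.
Qed.

Lemma exact_kernel (A B D : C) (f : mor A B) (g : mor B D) :
  is_mono f -> exact_at f g -> is_kernel g f.
Proof.
move=> fm fg; apply: kernelI => // [|X x gx0]; first exact: exact_at_comp0.
have [Q [c fc]] := ex_cokernel f; apply: (kernel_factor (mono_kernel fm fc)).
have [V [p [y [pe fy]]]] := exact_at_cover fg gx0.
by apply: (epi0 pe); rewrite -mcompA -fy mcompA fc.1 mcomp0m.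
Qed.

Lemma exact_at_epi (A B D : C) (f : mor A B) (g : mor B D) :
  exact_at f g -> g = 0 -> is_epi f.
Proof.
move=> fg g0; apply: epi_of_coker0 => X x xf0.
have [V [p [y [pe fy]]]] : exists (V : C) (p : mor V B) (y : mor V A),
    is_epi p /\ f ∘ y = idm B ∘ p.
  by apply: exact_at_cover fg _; rewrite g0 mcomp0m.
by apply: (epi0 pe); rewrite -(mcomp1m p) -fy mcompA xf0 mcomp0m.
Qed.

Lemma kernel_exact_at (A B D : C) (f : mor A B) (g : mor B D) :
  is_kernel g f -> exact_at f g.
Proof.
move=> gf; apply: exact_atI => [|W x gx0]; first exact: gf.1.
have [y <-] := kernel_factor gf gx0.
by exists W, (idm W), y; rewrite mcompm1; split=> // X u v; rewrite !mcompm1.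
Qed.

End Abelian.

(** * Functors and triangles *)

Section Functors.
Variables (C D : category) (F : functor C D).

Lemma fmapB (A B : C) (f g : mor A B) : fmap F (f - g) = fmap F f - fmap F g.
Proof. by rewrite fmapD fmapN. Qed.

Lemma fmap_iso (A B : C) (f : mor A B) : is_iso f -> is_iso (fmap F f).
Proof. by move=> [g [gf fg]]; exists (fmap F g); rewrite -!fmapM gf fg !fmap1. Qed.

Definition full := forall (A B : C) (f : mor (F A) (F B)), exists g, fmap F g = f.

Definition faithful := forall (A B : C) (f : mor A B), fmap F f = 0 -> f = 0.

Lemma faithful_inj : faithful -> forall (A B : C) (f g : mor A B),
  fmap F f = fmap F g -> f = g.
Proof.
move=> Ff A B f g fg; apply/eqP; rewrite -subr_eq0; apply/eqP/Ff.
by rewrite fmapB fg subrr.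
Qed.

End Functors.

Definition id_functor (C : category) : functor C C :=
  @Functor C C (fun A => A) (fun A B f => f)
    (fun A => erefl) (fun A B E g f => erefl) (fun A B f g => erefl).

Lemma is_iso1 (C : category) (A : C) : is_iso (idm A).
Proof. by exists (idm A); rewrite mcomp1m. Qed.

Lemma nat_iso_refl (C D : category) (F : functor C D) : nat_iso F F.
Proof.
exists (fun A => idm (F A)); split=> [A|A B f]; first exact: is_iso1.
by rewrite mcompm1 mcomp1m.
Qed.

Lemma nat_iso_sym (C D : category) (F G : functor C D) :
  nat_iso F G -> nat_iso G F.
Proof.
move=> [eta [etaI etaN]]; pose inv A := projT1 (cid (etaI A)).
have invK A : inv A ∘ eta A = idm (F A) := (projT2 (cid (etaI A))).1.
have Kinv A : eta A ∘ inv A = idm (G A) := (projT2 (cid (etaI A))).2.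
exists inv; split=> [A|A B f]; first by exists (eta A).
rewrite -[LHS]mcompm1 -(Kinv A) mcompA -(mcompA (inv B)) -etaN.
by rewrite (mcompA (inv B)) invK mcomp1m.
Qed.

Lemma nat_iso_trans (C D : category) (F G H : functor C D) :
  nat_iso F G -> nat_iso G H -> nat_iso F H.
Proof.
move=> [eta [etaI etaN]] [mu [muI muN]].
exists (fun A => mu A ∘ eta A); split=> [A|A B f]; first exact: iso_comp.
by rewrite -mcompA etaN mcompA muN -mcompA.
Qed.

Lemma nat_iso_compl (C D E : category) (G : functor D E) (F F' : functor C D) :
  nat_iso F F' -> nat_iso (fcomp G F) (fcomp G F').
Proof.
move=> [eta [etaI etaN]]; exists (fun A => fmap G (eta A)).
split=> [A|A B f]; first exact: (fmap_iso G (etaI A)).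
by rewrite /= -!fmapM etaN.
Qed.

Lemma nat_iso_compr (C D E : category) (G G' : functor D E) (F : functor C D) :
  nat_iso G G' -> nat_iso (fcomp G F) (fcomp G' F).
Proof.
move=> [eta [etaI etaN]]; exists (fun A => eta (F A)).
by split=> [A|A B f]; [exact: etaI|exact: etaN].
Qed.

Lemma nat_iso_fmap0 (C D : category) (F G : functor C D) (A B : C)
    (f : mor A B) : nat_iso F G -> fmap F f = 0 -> fmap G f = 0.
Proof.
move=> [eta [etaI etaN]] Ff0; apply: (epi0 (iso_epi (etaI A))).
by rewrite -etaN Ff0 mcompm0.
Qed.

Lemma nat_iso_id_faithful (C D : category) (H : functor C D)
    (K : functor D C) : nat_iso (fcomp K H) (id_functor C) -> faithful H.
Proof.
move=> iKH A B f Hf0; apply: (nat_iso_fmap0 iKH); rewrite /= Hf0.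
exact: fmap0.
Qed.

Lemma equivalence_full (C D : category) (H : functor C D) (K : functor D C) :
  nat_iso (fcomp K H) (id_functor C) -> nat_iso (fcomp H K) (id_functor D) ->
  full H.
Proof.
move=> iKH iHK A B f; have Kff := nat_iso_id_faithful iHK.
have [eta [etaI etaN]] := iKH; have [inv [invK Kinv]] := etaI A.
exists (eta B ∘ fmap K f ∘ inv); apply: (faithful_inj Kff).
have [inv' [inv'K Kinv']] := etaI B.
(* Naturality of eta at the candidate preimage itself computes the image of the candidate under K
   H. *)
have /(congr1 (fun x => inv' ∘ x)) := etaN _ _ (eta B ∘ fmap K f ∘ inv).
rewrite /= mcompA inv'K mcomp1m => ->.
by rewrite -!mcompA invK mcompm1 mcompA inv'K mcomp1m.
Qed.

Section ExactFunctors.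
Variables (C D : category) (F : functor C D).
Hypotheses (abC : is_abelian C) (exF : exact_functor F).

Lemma exact_functor_epi (A B : C) (e : mor A B) : is_epi e -> is_epi (fmap F e).
Proof.
move=> ee; have [K [k ek]] := ex_kernel abC e.
have [_ /cokernel_epi //] := exF (conj ek (epi_cokernel abC ee ek)).
Qed.

(** [exact_functor] speaks of short exact sequences only. Writing f as an epimorphism followed by
    the kernel of q reduces to that case, because precomposing with an epimorphism keeps the
    cokernel. *)
Lemma exact_functor_cokernel (A B Q : C) (f : mor A B) (q : mor B Q) :
  is_cokernel f q -> is_cokernel (fmap F f) (fmap F q).
Proof.
move=> fq; have [M [m qm]] := ex_kernel abC q.
have fm : is_image f m by exists Q, q.
have [e ee <-] := image_factor abC fm; rewrite fmapM.
apply: cokernel_comp_epi; first exact: exact_functor_epi.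
have qe := cokernel_epi fq.
by have [_] := exF (conj qm (epi_cokernel abC qe qm)).
Qed.

End ExactFunctors.

Lemma exact_functor_id (C : category) : exact_functor (id_functor C).
Proof. by []. Qed.

Lemma exact_functor_comp (C D E : category) (G : functor D E)
    (F : functor C D) :
  exact_functor G -> exact_functor F -> exact_functor (fcomp G F).
Proof. by move=> exG exF X Y Z f g /exF /exG. Qed.

Lemma stable_functor_comp (C D E : stable_additive) (G : functor D E)
    (F : functor C D) :
  stable_functor G -> stable_functor F -> stable_functor (fcomp G F).
Proof.
move=> stG stF.
exact: (nat_iso_trans (nat_iso_compl G stF) (nat_iso_compr F stG)).
Qed.

Section Automorphisms.
Variables (C : category) (S : functor C C).
Hypothesis autS : is_automorphism S.

Lemma aut_obj (A : C) : exists A', S A' = A.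
Proof. by have [[g _ gK] _] := autS; exists (g A). Qed.

Lemma aut_full : full S.
Proof. by move=> A B f; have [_ /(_ A B)[g _ gK]] := autS; exists (g f). Qed.

Lemma aut_inj (A B : C) : injective (@fmap _ _ S A B).
Proof. by have [_ /(_ A B)/bij_inj] := autS. Qed.

Lemma aut_exact : exact_functor S.
Proof.
move=> X Y Z f g [gf fg]; have gf0 : fmap S g ∘ fmap S f = 0.
  by rewrite -fmapM gf.1 fmap0.
split.
  apply: kernelI => // [W x y|W x].
    have [W' EW] := aut_obj W; subst W.
    have [[x' <-] [y' <-]] := (aut_full x, aut_full y).
    by rewrite -!fmapM => /aut_inj /(kernel_mono gf) ->.
  have [W' EW] := aut_obj W; subst W; have [x' <-] := aut_full x.
  rewrite -fmapM -(fmap0 S) => /aut_inj /(kernel_factor gf)[y <-].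
  by exists (fmap S y); rewrite fmapM.
apply: cokernelI => // [W x y|W x].
  have [W' EW] := aut_obj W; subst W.
  have [[x' <-] [y' <-]] := (aut_full x, aut_full y).
  by rewrite -!fmapM => /aut_inj /(cokernel_epi fg) ->.
have [W' EW] := aut_obj W; subst W; have [x' <-] := aut_full x.
rewrite -fmapM -(fmap0 S) => /aut_inj /(cokernel_factor fg)[y <-].
by exists (fmap S y); rewrite fmapM.
Qed.

End Automorphisms.

Section Triangles.
Variable T : triangulated.
Let autT : is_automorphism (@susp T) := susp_aut T.

Lemma zero_obj_susp (Z : T) : is_zero_obj Z -> is_zero_obj (susp Z).
Proof.
move=> [Z0 _]; have id0 : idm (susp Z) = 0 by rewrite -fmap1 (Z0 _ (idm Z)) fmap0.
split=> A f; first by rewrite -(mcomp1m f) id0 mcomp0m.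
by rewrite -(mcompm1 f) id0 mcompm0.
Qed.

Lemma ex_zero_obj : exists Z : T, is_zero_obj Z.
Proof. by case: (stable_is_additive T). Qed.

Variables (A B D : T) (f : mor A B) (g : mor B D) (h : mor D (susp A)).
Hypothesis fgh : tri f g h.

Lemma tri_comp0 : g ∘ f = 0.
Proof.
have [Z Z0] := ex_zero_obj.
by have [c [<- _]] := tri_fill (tri_id A Z0) fgh (erefl (f ∘ idm A));
  rewrite mcompm0.
Qed.

(** TR3 fills in only the third component of a morphism of triangles. Both the identity triangle of
    W and the given one are therefore rotated once; the filler then goes from susp W to susp A and
    is desuspended. *)
Lemma tri_weak_kernel (W : T) (x : mor W B) : g ∘ x = 0 -> exists y, f ∘ y = x.
Proof.
move=> gx0; have [Z Z0] := ex_zero_obj.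
have := (tri_rot _ _ _).1 (tri_id W Z0) => triW.
have := (tri_rot _ _ _).1 fgh => triB.
have [|c [_]] := tri_fill (a := x) (b := 0) triW triB.
  by rewrite gx0 mcomp0m.
have [c' <-] := aut_full autT c.
rewrite mcompNr mcompNl fmap1 mcompm1 => /oppr_inj; rewrite -fmapM.
by move=> /(aut_inj autT) ->; exists c'.
Qed.

Lemma tri_weak_cokernel (W : T) (x : mor B W) :
  x ∘ f = 0 -> exists y, y ∘ g = x.
Proof.
move=> xf0; have [Z Z0] := ex_zero_obj.
(* An identity triangle rotated backwards; its third vertex is written as a suspension of a zero
   object. *)
have triW : tri (0 : mor Z W) (idm W) (0 : mor W (susp Z)).
  apply/tri_rot; rewrite fmap0 oppr0.
  exact: tri_id (zero_obj_susp Z0).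
have [|c [cg _]] := tri_fill (a := 0) (b := x) fgh triW.
  by rewrite xf0 mcomp0m.
by exists c; rewrite cg mcomp1m.
Qed.

End Triangles.

Lemma tri_cocone (T : triangulated) (P A : T) (p : mor P A) :
  exists (K : T) (k : mor K P) (h : mor A (susp K)), tri k p h.
Proof.
have [D [g [h pgh]]] := tri_cone p.
have [K EK] := aut_obj (susp_aut T) D; subst D.
have [k kh] := aut_full (susp_aut T) (- h).
by exists K, k, g; apply/tri_rot; rewrite kh opprK.
Qed.

(** * Adapted objects *)

Section AdaptedObjects.
Variables (T C : category) (F : functor T C).

(* On projective objects of C, an adapted L represents C(F L, F -): it plays
   the role of the left adjoint of F at the projective object F L. *)
Definition adapted (L : T) : Prop :=
  [/\ projective (F L),
      forall (B : T) (f : mor (F L) (F B)), exists g, fmap F g = f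
    & forall (B : T) (g : mor L B), fmap F g = 0 -> g = 0].

Definition enough_adapted : Prop :=
  forall A : C, exists (L : T) (e : mor (F L) A), adapted L /\ is_epi e.

(** The start of a projective resolution of A whose objects and differential come from T, so that
    any functor on T can be applied to it. *)
Record presentation (A : C) := Presentation {
  pres1 : T;
  pres0 : T;
  pres_d : mor pres1 pres0;
  pres_e : mor (F pres0) A;
  pres1_adapted : adapted pres1;
  pres0_adapted : adapted pres0;
  pres_cokernel : is_cokernel (fmap F pres_d) pres_e }.

Lemma pres_epi (A : C) (P : presentation A) : is_epi (pres_e P).
Proof. exact: cokernel_epi (pres_cokernel P). Qed.

Lemma adapted_lift (L M : T) (B : C) (e : mor (F M) B) (x : mor (F L) B) :
  adapted L -> is_epi e -> exists f : mor L M, e ∘ fmap F f = x.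
Proof.
move=> [pL fuL _] ee; have [y eyx] := pL _ _ e x ee.
by have [f Ff] := fuL _ y; exists f; rewrite Ff.
Qed.

Hypothesis abC : is_abelian C.

(** Exactness in C gives the factorization after F; faithfulness on morphisms out of L makes it an
    equation in T, which any other functor on T then preserves. *)
Lemma adapted_lift_ker (L : T) (B : C) (Q : presentation B)
    (x : mor L (pres0 Q)) :
  adapted L -> pres_e Q ∘ fmap F x = 0 -> exists s, pres_d Q ∘ s = x.
Proof.
move=> [pL fuL faL] ex0.
have [y dy] := exact_at_projective abC pL
  (cokernel_exact abC (pres_cokernel Q)) ex0.
have [s Fs] := fuL _ y; exists s; apply/eqP; rewrite -subr_eq0; apply/eqP/faL.
by rewrite fmapB fmapM Fs dy subrr.
Qed.

Lemma ex_presentation : enough_adapted ->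
  forall A : C, inhabited (presentation A).
Proof.
move=> enF A; have [L0 [e [aL0 ee]]] := enF A.
have [K [k ek]] := ex_kernel abC e; have [L1 [q [aL1 qe]]] := enF K.
have [_ /(_ _ (k ∘ q))[d Fd] _] := aL1.
exists; apply: (@Presentation A L1 L0 d e) => //.
by rewrite Fd; apply: cokernel_comp_epi => //; apply: epi_cokernel.
Qed.

Section Induced.
Variables (D : category) (G : functor T D) (A B : C).
Variables (P : presentation A) (Q : presentation B) (f : mor A B).

Lemma ex_lift : exists f0 : mor (pres0 P) (pres0 Q),
  pres_e Q ∘ fmap F f0 = f ∘ pres_e P.
Proof. exact: adapted_lift (pres0_adapted P) (pres_epi (P := Q)). Qed.

Lemma lift_kills (Y : D) (pi : mor (G (pres0 Q)) Y)
    (f0 : mor (pres0 P) (pres0 Q)) :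
  pi ∘ fmap G (pres_d Q) = 0 -> pres_e Q ∘ fmap F f0 = f ∘ pres_e P ->
  (pi ∘ fmap G f0) ∘ fmap G (pres_d P) = 0.
Proof.
move=> pid0 ef0; have [|s dQs] := adapted_lift_ker (Q := Q) (x := f0 ∘ pres_d P)
  (pres1_adapted P).
  by rewrite fmapM mcompA ef0 -mcompA (pres_cokernel P).1 mcompm0.
by rewrite -mcompA -fmapM -dQs fmapM mcompA pid0 mcomp0m.
Qed.

Lemma lift_unique (Y : D) (pi : mor (G (pres0 Q)) Y)
    (f0 f1 : mor (pres0 P) (pres0 Q)) :
  pi ∘ fmap G (pres_d Q) = 0 ->
  pres_e Q ∘ fmap F f0 = pres_e Q ∘ fmap F f1 ->
  pi ∘ fmap G f0 = pi ∘ fmap G f1.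
Proof.
move=> pid0 ef; have [|s dQs] := adapted_lift_ker (Q := Q) (x := f0 - f1)
  (pres0_adapted P).
  by rewrite fmapB mcompBr ef subrr.
apply/eqP; rewrite -subr_eq0 -mcompBr -fmapB -dQs fmapM mcompA pid0.
by rewrite mcomp0m.
Qed.

(** The equation for u is stated for every lift f0 at once, so that functoriality can be checked
    with whichever lift is convenient. *)
Lemma ex_induced (X Y : D) (piX : mor (G (pres0 P)) X)
    (piY : mor (G (pres0 Q)) Y) :
  is_cokernel (fmap G (pres_d P)) piX -> piY ∘ fmap G (pres_d Q) = 0 ->
  exists u : mor X Y, forall f0,
    pres_e Q ∘ fmap F f0 = f ∘ pres_e P -> u ∘ piX = piY ∘ fmap G f0.
Proof.
move=> cX cY; have [f0 ef0] := ex_lift.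
have [u upi] := cokernel_factor cX (lift_kills cY ef0).
exists u => f1 ef1; rewrite upi; apply: lift_unique => //.
by rewrite ef0.
Qed.

End Induced.

End AdaptedObjects.

Lemma cokernel_iso (D : category) (A B Q A' B' Q' : D) (f : mor A B)
    (q : mor B Q) (f' : mor A' B') (q' : mor B' Q') (a : mor A A')
    (b : mor B B') (u : mor Q Q') :
  is_cokernel f q -> is_cokernel f' q' -> is_iso a -> is_iso b ->
  b ∘ f = f' ∘ a -> u ∘ q = q' ∘ b -> is_iso u.
Proof.
move=> fq f'q' [a' [a'a aa']] [b' [b'b bb']] sq uq.
have [v vq] : exists v, v ∘ q' = q ∘ b'.
  apply: (cokernel_factor f'q'); rewrite -(mcompm1 f') -aa' (mcompA f') -sq.
  by rewrite -!mcompA (mcompA b') b'b mcomp1m mcompA fq.1 mcomp0m.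
exists v; split.
  apply: (cokernel_epi fq).
  by rewrite -mcompA uq mcompA vq -mcompA b'b mcompm1 mcomp1m.
apply: (cokernel_epi f'q').
by rewrite -mcompA vq mcompA uq -mcompA bb' mcompm1 mcomp1m.
Qed.

(* Exact functors preserve the cokernels given by presentations, so only their
   values on adapted objects matter. *)
Lemma exact_functor_unique (T C D : category) (F : functor T C)
    (H H' : functor C D) :
  is_abelian C -> enough_adapted F -> exact_functor H -> exact_functor H' ->
  nat_iso (fcomp H F) (fcomp H' F) -> nat_iso H H'.
Proof.
move=> abC enF exH exH' [theta [thetaI thetaN]].
pose P A := inhabited_witness (ex_presentation abC enF A).
have cokP (K : functor C D) (exK : exact_functor K) A :
    is_cokernel (fmap K (fmap F (pres_d (P A)))) (fmap K (pres_e (P A))).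
  exact: exact_functor_cokernel (pres_cokernel (P A)).
have ex A : exists u : mor (H A) (H' A),
    u ∘ fmap H (pres_e (P A)) = fmap H' (pres_e (P A)) ∘ theta (pres0 (P A)).
  apply: (cokernel_factor (cokP H exH A)); rewrite -mcompA.
  have /= -> := thetaN _ _ (pres_d (P A)).
  by rewrite mcompA -fmapM (pres_cokernel (P A)).1 fmap0 mcomp0m.
exists (fun A => projT1 (cid (ex A))); split=> [A|A B f].
  case: (cid _) => u /= ue.
  apply: (cokernel_iso (cokP H exH A) (cokP H' exH' A) _ _ _ ue).
  - exact: thetaI.
  - exact: thetaI.
  - exact: (thetaN _ _ (pres_d (P A))).
case: (cid _) => u /= ue; case: (cid _) => v /= ve.
have [f0 ef0] := ex_lift (P A) (P B) f.
apply: (cokernel_epi (cokP H exH A)); rewrite -!mcompA ve -fmapM -ef0 fmapM.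
rewrite mcompA ue -mcompA; have /= -> := thetaN _ _ f0.
by rewrite !mcompA -!fmapM ef0.
Qed.

(** * Universality *)

Section Universality.
Variables (T : triangulated) (I : ideal T) (C : stable_abelian).
Variable F : functor T C.
Hypotheses (hF : homological F) (kerF : ideal_sub (ker F) I).
Hypotheses (FI : ideal_exact I F) (enF : enough_adapted F).

Let abC : is_abelian C := stable_is_abelian C.

Lemma adapted_ideal_projective (L : T) : adapted F L -> ideal_projective I L.
Proof.
by move=> [_ _ faL] X Y f /FI Ff0 x; apply: faL; rewrite fmapM Ff0 mcomp0m.
Qed.

Lemma adapted_enough_ideal_projectives : enough_ideal_projectives I.
Proof.
move=> A; have [L [e [aL ee]]] := enF (F A); have [_ fuL _] := aL.
have [p Fp] := fuL _ e; exists L, p; split; first exact: adapted_ideal_projective.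
have [D [g [h pgh]]] := tri_cone p; exists D, g, h; split=> //; apply: kerF.
by apply: (epi0 ee); rewrite -Fp -fmapM (tri_comp0 pgh) fmap0.
Qed.

Definition pres (A : C) : presentation F A :=
  inhabited_witness (ex_presentation abC enF A).

Section Extension.
Variables (C' : stable_abelian) (G : functor T C').
Hypotheses (hG : homological G) (GI : ideal_exact I G).

Let abC' : is_abelian C' := stable_is_abelian C'.

Lemma epi_transfer (A B : T) (p : mor A B) :
  is_epi (fmap F p) -> is_epi (fmap G p).
Proof.
move=> Fpe; have [D [g [h pgh]]] := tri_cone p.
apply: (exact_at_epi abC' (hG pgh)); apply: GI; apply: kerF.
by apply: (epi0 Fpe); rewrite -fmapM (tri_comp0 pgh) fmap0.
Qed.

(** Complete p to a triangle K -> pres0 -> A. By homologicality and [epi_transfer], G p is a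
    cokernel of G k. After covering K by an adapted object, k factors through [pres_d], so whatever
    kills G of the differential also kills G k. *)
Lemma pres_cokernel_image (A : T) (P : presentation F (F A))
    (p : mor (pres0 P) A) :
  fmap F p = pres_e P -> is_cokernel (fmap G (pres_d P)) (fmap G p).
Proof.
move=> Fp; have Fpe : is_epi (fmap F p) by rewrite Fp; exact: pres_epi.
have Gpe := epi_transfer Fpe; apply: cokernelI => //.
  have [_ _ faP] := pres1_adapted P.
  rewrite -fmapM (faP _ (p ∘ pres_d P)) ?fmap0 //.
  by rewrite fmapM Fp (pres_cokernel P).1.
move=> X x xGd0; have [K [k [h kph]]] := tri_cocone p.
apply: (cokernel_factor (exact_cokernel abC' Gpe (hG kph))).
have [L [q [aL qe]]] := enF (F K).
have [_ /(_ _ q)[q' Fq'] _] := aL.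
have Gq'e : is_epi (fmap G q') by apply: epi_transfer; rewrite Fq'.
apply: (epi0 Gq'e); have [|s ds] := adapted_lift_ker (Q := P) (x := k ∘ q') abC aL.
  by rewrite -Fp -fmapM mcompA (tri_comp0 kph) mcomp0m fmap0.
by rewrite -mcompA -fmapM -ds fmapM mcompA xGd0 mcomp0m.
Qed.

Definition ext_obj (A : C) : C' :=
  projT1 (cid (ex_cokernel abC' (fmap G (pres_d (pres A))))).

Definition ext_pi (A : C) : mor (G (pres0 (pres A))) (ext_obj A) :=
  projT1 (cid (projT2 (cid (ex_cokernel abC' (fmap G (pres_d (pres A))))))).

Lemma ext_cokernel (A : C) : is_cokernel (fmap G (pres_d (pres A))) (ext_pi A).
Proof. exact: (projT2 (cid (projT2 (cid (ex_cokernel abC' _))))). Qed.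

Lemma ext_pi_epi (A : C) : is_epi (ext_pi A).
Proof. exact: cokernel_epi (ext_cokernel A). Qed.

Definition ext_map (A B : C) (f : mor A B) : mor (ext_obj A) (ext_obj B) :=
  projT1 (cid (ex_induced abC f (ext_cokernel A) (ext_cokernel B).1)).

Lemma ext_mapE (A B : C) (f : mor A B) (f0 : mor (pres0 (pres A)) (pres0 (pres B))) :
  pres_e (pres B) ∘ fmap F f0 = f ∘ pres_e (pres A) ->
  ext_map f ∘ ext_pi A = ext_pi B ∘ fmap G f0.
Proof.
exact: (projT2 (cid (ex_induced abC f (ext_cokernel A) (ext_cokernel B).1))).
Qed.

Lemma ext_map1 (A : C) : ext_map (idm A) = idm (ext_obj A).
Proof.
apply: ext_pi_epi; rewrite (@ext_mapE _ _ _ (idm _)) ?fmap1 ?mcomp1m ?mcompm1 //.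
Qed.

Lemma ext_mapM (A B D : C) (g : mor B D) (f : mor A B) :
  ext_map (g ∘ f) = ext_map g ∘ ext_map f.
Proof.
have [f0 ef0] := ex_lift (pres A) (pres B) f.
have [g0 eg0] := ex_lift (pres B) (pres D) g.
apply: ext_pi_epi; rewrite (@ext_mapE _ _ _ (g0 ∘ f0)); last first.
  by rewrite fmapM mcompA eg0 -mcompA ef0 mcompA.
by rewrite -mcompA (ext_mapE ef0) fmapM !mcompA (ext_mapE eg0).
Qed.

Lemma ext_mapD (A B : C) (f g : mor A B) :
  ext_map (f + g) = ext_map f + ext_map g.
Proof.
have [f0 ef0] := ex_lift (pres A) (pres B) f.
have [g0 eg0] := ex_lift (pres A) (pres B) g.
apply: ext_pi_epi; rewrite (@ext_mapE _ _ _ (f0 + g0)); last first.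
  by rewrite fmapD mcompDr ef0 eg0 mcompDl.
by rewrite mcompDl (ext_mapE ef0) (ext_mapE eg0) fmapD mcompDr.
Qed.

(* The zeroth left derived functor of G composed with the partial left adjoint
   of F. *)
Definition ext : functor C C' := Functor ext_map1 ext_mapM ext_mapD.

Lemma ext_nat_iso : nat_iso (fcomp ext F) G.
Proof.
have exp A : exists p, fmap F p = pres_e (pres (F A)).
  by have [_ fuP _] := pres0_adapted (pres (F A)); exact: fuP.
pose p A := projT1 (cid (exp A)).
have Fp A : fmap F (p A) = pres_e (pres (F A)) := projT2 (cid (exp A)).
have cokGp A := pres_cokernel_image (Fp A).
have ex A : exists u, u ∘ ext_pi (F A) = fmap G (p A).
  by apply: (cokernel_factor (ext_cokernel (F A))); exact: (cokGp A).1.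
exists (fun A => projT1 (cid (ex A))); split=> [A|A B f].
  case: (cid _) => u /= ue.
  apply: (cokernel_iso (ext_cokernel (F A)) (cokGp A) (is_iso1 _) (is_iso1 _)).
    by rewrite mcomp1m mcompm1.
  by rewrite mcompm1.
case: (cid _) => u /= ue; case: (cid _) => v /= ve.
have [f0 ef0] := ex_lift (pres (F A)) (pres (F B)) (fmap F f).
apply: ext_pi_epi; rewrite -!mcompA ve (ext_mapE ef0) mcompA ue -!fmapM.
congr (fmap G _); apply/eqP; rewrite -subr_eq0; apply/eqP.
have [_ _ faP] := pres0_adapted (pres (F A)); apply: faP.
by rewrite fmapB !fmapM !Fp ef0 subrr.
Qed.

(** Lifting [pres_e] of Y through the epimorphism f ∘ [pres_e] of X gives s backwards between the
    generators. Both f0 ∘ s and the identity lift [idm Y], so they agree after [ext_pi]. *)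
Lemma ext_epi (X Y : C) (f : mor X Y) : is_epi f -> is_epi (ext_map f).
Proof.
move=> fe; have [f0 ef0] := ex_lift (pres X) (pres Y) f.
have [s es] := adapted_lift (pres_e (pres Y)) (pres0_adapted (pres Y))
  (epi_comp fe (pres_epi (P := pres X))).
apply: (@epi_compl _ _ _ _ _ (ext_pi X ∘ fmap G s)).
rewrite mcompA (ext_mapE ef0) -mcompA -fmapM.
rewrite (_ : _ ∘ _ = ext_pi Y); first exact: ext_pi_epi.
rewrite -[RHS]mcompm1 -fmap1; apply: (lift_unique abC (P := pres Y)) => //.
  exact: (ext_cokernel Y).1.
by rewrite fmapM mcompA ef0 es fmap1 mcompm1.
Qed.

(** A generalized element of the middle term is traced back, through covers in C', to a morphism of
    T out of an adapted object L. The exactness of i and j in C is used on F L, and the resulting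
    equation in T is transported by G. *)
Lemma ext_exact_at (X Y Z : C) (i : mor X Y) (j : mor Y Z) :
  exact_at i j -> exact_at (ext_map i) (ext_map j).
Proof.
move=> ij; have [i0 ei0] := ex_lift (pres X) (pres Y) i.
have [j0 ej0] := ex_lift (pres Y) (pres Z) j.
apply: exact_atI => // [|W y jy0].
  by rewrite -ext_mapM (exact_at_comp0 abC ij); exact: (fmap0 ext).
(* Represent y by y1 in G of the generators of Y; its image under j0 is then, on a further cover, a
   relation of Z. *)
have [W1 [p1 [y1 [p1e piy1]]]] := pullback_epi abC' y (ext_pi_epi (A := Y)).
have [|W2 [p2 [z [p2e dz]]]] := exact_at_cover abC'
    (cokernel_exact abC' (ext_cokernel Z)) (x := fmap G j0 ∘ y1).
  by rewrite mcompA -(ext_mapE ej0) -mcompA piy1 mcompA jy0 mcomp0m.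
have [_ bp] := stable_is_additive T.
have [S [a1 [a2 [q1 [q2 [q1a1 q2a2 q2a1 q1a2 S1]]]]]] :=
  bp (pres0 (pres Y)) (pres1 (pres Z)).
(* K is a weak pullback of j0 and the differential of Z. The pair (y1, z), assembled as w, lifts to
   G K because G is homological. *)
have [K [k [h kh]]] := tri_cocone (j0 ∘ q1 - pres_d (pres Z) ∘ q2).
pose w := fmap G a1 ∘ (y1 ∘ p2) + fmap G a2 ∘ z.
have q1w : fmap G q1 ∘ w = y1 ∘ p2.
  rewrite mcompDr !mcompA -!fmapM q1a1 q1a2 fmap1 fmap0 mcomp0m addr0.
  by rewrite -mcompA mcomp1m.
have q2w : fmap G q2 ∘ w = z.
  rewrite mcompDr !mcompA -!fmapM q2a1 q2a2 fmap1 fmap0 !mcomp0m add0r.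
  by rewrite mcomp1m.
have [|W3 [p3 [t [p3e kt]]]] := exact_at_cover abC' (hG kh) (x := w).
  by rewrite fmapB !fmapM mcompBl -!mcompA q1w q2w dz mcompA subrr.
(* K need not be adapted, so it is replaced by an adapted cover, which G preserves. *)
have [L [q [aL qe]]] := enF (F K); have [_ /(_ _ q)[c Fc] _] := aL.
have Gce : is_epi (fmap G c) by apply: epi_transfer; rewrite Fc.
have [W4 [p4 [r [p4e cr]]]] := pullback_epi abC' t Gce.
have jk : j0 ∘ (q1 ∘ k) = pres_d (pres Z) ∘ (q2 ∘ k).
  by apply/eqP; rewrite -subr_eq0 !mcompA -mcompBl (tri_comp0 kh).
(* Here the morphism from F L to Y is killed by j, hence comes from X. Lifting x to x0 leaves an
   error that vanishes in Y, so it factors through the differential of Y and dies under [ext_pi]. *)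
have [|x ix] := exact_at_projective abC (x := pres_e (pres Y) ∘ fmap F (q1 ∘ k ∘ c))
    (let: And3 pL _ _ := aL in pL) ij.
  rewrite mcompA -ej0 -mcompA -fmapM mcompA jk !fmapM !mcompA.
  by rewrite (pres_cokernel (pres Z)).1 !mcomp0m.
have [x0 ex0] := adapted_lift x aL (pres_epi (P := pres X)).
have [|s ds] := adapted_lift_ker (Q := pres Y)
    (x := q1 ∘ k ∘ c - i0 ∘ x0) abC aL.
  by rewrite fmapB mcompBr (fmapM F i0) mcompA ei0 -(mcompA i) ex0 ix subrr.
exists W4, (p1 ∘ p2 ∘ p3 ∘ p4), (ext_pi X ∘ fmap G x0 ∘ r); split.
  by do 3!apply: epi_comp => //.
rewrite !mcompA (ext_mapE ei0) -piy1.
have -> : ext_pi Y ∘ y1 ∘ p2 ∘ p3 ∘ p4 = ext_pi Y ∘ fmap G (q1 ∘ k ∘ c) ∘ r.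
  rewrite !fmapM -!mcompA cr (mcompA (fmap G k)) kt.
  by rewrite !mcompA -(mcompA _ (fmap G q1)) q1w !mcompA.
congr (_ ∘ r); apply/esym/eqP; rewrite -(mcompA (ext_pi Y)) -fmapM.
rewrite -subr_eq0 -mcompBr -fmapB.
by rewrite -ds fmapM mcompA (ext_cokernel Y).1 mcomp0m.
Qed.

Lemma ext_exact : exact_functor ext.
Proof.
move=> X Y Z f g [gf fg]; have gfex : exact_at (ext_map f) (ext_map g).
  exact/ext_exact_at/kernel_exact_at.
split; last by apply: exact_cokernel => //; apply: ext_epi; exact: cokernel_epi fg.
apply: exact_kernel => //; apply: mono_of_ker0 => W x fx0.
(* Being mono is exactness after a zero map; taking that map on X itself lets [ext_exact_at] apply
   directly. *)
have f0 : exact_at (0 : mor X X) f.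
  apply: exact_atI => // [|V v fv0]; first by rewrite mcompm0.
  exists V, (idm V), v; split; first exact: iso_epi (is_iso1 V).
  by rewrite mcomp0m mcompm1 (mono0 (kernel_mono gf) fv0).
have [V [p [y [pe]]]] := exact_at_cover abC' (ext_exact_at f0) fx0.
rewrite (_ : ext_map 0 = 0); last exact: (fmap0 ext).
by rewrite mcomp0m => xp0; apply: (epi0 pe).
Qed.

End Extension.

Lemma adapted_universal : stable_functor F -> universal I F.
Proof.
move=> stF; split=> // C' G [hG stG] GI factors.
have uniq H H' : factors H -> factors H' -> nat_iso H H'.
  move=> [exH _ HF] [exH' _ HF']; apply: (exact_functor_unique abC enF) => //.
  exact: nat_iso_trans HF (nat_iso_sym HF').
split=> //; exists (ext G).
have extF : nat_iso (fcomp (ext G) F) G by apply: ext_nat_iso.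
have exact_ext : exact_functor (ext G) by apply: ext_exact.
(* Stability needs no construction: the extension followed by the suspension, and preceded by it,
   are exact functors that agree after composition with F. *)
split=> //; apply: (exact_functor_unique abC enF).
- exact: exact_functor_comp exact_ext (aut_exact (susp_aut C)).
- exact: exact_functor_comp (aut_exact (susp_aut C')) exact_ext.
- have stF' := nat_iso_compl (ext G) (nat_iso_sym stF).
  have extFS := nat_iso_compr susp extF.
  have extSF := nat_iso_compl susp (nat_iso_sym extF).
  exact: nat_iso_trans stF' (nat_iso_trans extFS (nat_iso_trans stG extSF)).
Qed.

End Universality.

(** * The Freyd category of a full subcategory *)

(** Subgroups are given by arbitrary predicates, since the conditions cutting out the morphisms of
    the Freyd category, and those identifying them, are existential statements. *)
Record subquotient (V : zmodType) := Subquotient {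
  sq_sub : V -> Prop;
  sq_rel : V -> Prop;
  sq_subB : forall v w, sq_sub v -> sq_sub w -> sq_sub (v - w);
  sq_rel0 : sq_rel 0;
  sq_relB : forall v w, sq_rel v -> sq_rel w -> sq_rel (v - w);
  sq_rel_sub : forall v, sq_rel v -> sq_sub v }.

Section Subquotient.
Variables (V : zmodType) (D : subquotient V).

Lemma sq_relN v : sq_rel D v -> sq_rel D (- v).
Proof. by move=> Rv; rewrite -sub0r; apply: sq_relB => //; exact: sq_rel0. Qed.

Lemma sq_relD v w : sq_rel D v -> sq_rel D w -> sq_rel D (v + w).
Proof. by move=> Rv /sq_relN Rw; rewrite -(opprK w); exact: sq_relB. Qed.

Lemma sq_sub0 : sq_sub D 0.
Proof. exact/sq_rel_sub/sq_rel0. Qed.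

Lemma sq_subN v : sq_sub D v -> sq_sub D (- v).
Proof. by move=> Sv; rewrite -sub0r; apply: sq_subB => //; exact: sq_sub0. Qed.

Lemma sq_subD v w : sq_sub D v -> sq_sub D w -> sq_sub D (v + w).
Proof. by move=> Sv /sq_subN Sw; rewrite -(opprK w); exact: sq_subB. Qed.

Lemma sq_ex_canon v : exists w, `[< sq_rel D (w - v) >].
Proof. by exists v; apply/asboolP; rewrite subrr; exact: sq_rel0. Qed.

(* A class is encoded by its canonical representative. *)
Definition sq_canon v := xchoose (sq_ex_canon v).

Lemma sq_canon_rel v : sq_rel D (sq_canon v - v).
Proof. exact/asboolP/(xchooseP (sq_ex_canon v)). Qed.

(** [xchoose] depends only on the extension of the predicate, and v and w have the same class. *)
Lemma sq_canon_eq v w : sq_rel D (v - w) -> sq_canon v = sq_canon w.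
Proof.
move=> Rvw; apply: eq_xchoose => u; apply/asboolP/asboolP => Ru.
  by rewrite -(subrKA v); exact: sq_relD.
by rewrite -(subrKA w) -(opprB v); exact: sq_relB.
Qed.

(** The condition is made boolean so that [sq] is a subtype of V: it inherits a choice structure,
    and equality is equality of representatives. *)
Record sq := Sq { sq_val : V; _ : `[< sq_sub D sq_val /\ sq_canon sq_val = sq_val >] }.

HB.instance Definition _ := [isSub for sq_val].
HB.instance Definition _ := [Choice of sq by <:].

Lemma sq_valP (x : sq) : sq_sub D (sq_val x).
Proof. by case: x => v /= /asboolP[]. Qed.

Lemma sq_cls_subproof v (Sv : sq_sub D v) :
  `[< sq_sub D (sq_canon v) /\ sq_canon (sq_canon v) = sq_canon v >].
Proof.
apply/asboolP; split; last exact/sq_canon_eq/sq_canon_rel.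
rewrite -(subrK v (sq_canon v)); apply: sq_subD => //.
exact/sq_rel_sub/sq_canon_rel.
Qed.

Definition sq_cls v (Sv : sq_sub D v) : sq := Sq (sq_cls_subproof Sv).

Lemma sq_cls_eq v w (Sv : sq_sub D v) (Sw : sq_sub D w) :
  sq_cls Sv = sq_cls Sw <-> sq_rel D (v - w).
Proof.
split=> [/(congr1 sq_val)/= vw|Rvw]; last exact/val_inj/sq_canon_eq.
rewrite -(subrKA (sq_canon v)) {2}vw; apply: sq_relD; last exact: sq_canon_rel.
by rewrite -opprB; exact/sq_relN/sq_canon_rel.
Qed.

Lemma sq_cls_congr v w (Sv : sq_sub D v) (Sw : sq_sub D w) :
  v = w -> sq_cls Sv = sq_cls Sw.
Proof. by move=> vw; apply/sq_cls_eq; rewrite vw subrr; exact: sq_rel0. Qed.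

Lemma sq_valK x : sq_cls (sq_valP x) = x.
Proof. by apply: val_inj; case: x => v /= /asboolP[]. Qed.

Lemma sq_clsP (x : sq) : exists v (Sv : sq_sub D v), x = sq_cls Sv.
Proof. by exists (sq_val x), (sq_valP x); rewrite sq_valK. Qed.

Lemma sq_val_rel v (Sv : sq_sub D v) : sq_rel D (sq_val (sq_cls Sv) - v).
Proof. exact: sq_canon_rel. Qed.

Definition sq_add (x y : sq) := sq_cls (sq_subD (sq_valP x) (sq_valP y)).
Definition sq_opp (x : sq) := sq_cls (sq_subN (sq_valP x)).

Lemma sq_addE v w (Sv : sq_sub D v) (Sw : sq_sub D w) :
  sq_add (sq_cls Sv) (sq_cls Sw) = sq_cls (sq_subD Sv Sw).
Proof.
by apply/sq_cls_eq; rewrite opprD addrACA; apply: sq_relD; exact: sq_val_rel.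
Qed.

Lemma sq_oppE v (Sv : sq_sub D v) : sq_opp (sq_cls Sv) = sq_cls (sq_subN Sv).
Proof. by apply/sq_cls_eq; rewrite -opprD; apply: sq_relN; exact: sq_val_rel. Qed.

Lemma sq_addA : associative sq_add.
Proof.
move=> x y z; have [u [Su ->]] := sq_clsP x; have [v [Sv ->]] := sq_clsP y.
have [w [Sw ->]] := sq_clsP z.
by rewrite !sq_addE; apply: sq_cls_congr; rewrite addrA.
Qed.

Lemma sq_addC : commutative sq_add.
Proof.
move=> x y; have [u [Su ->]] := sq_clsP x; have [v [Sv ->]] := sq_clsP y.
by rewrite !sq_addE; apply: sq_cls_congr; rewrite addrC.
Qed.

Lemma sq_add0 : left_id (sq_cls sq_sub0) sq_add.
Proof.
move=> x; have [u [Su ->]] := sq_clsP x.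
by rewrite sq_addE; apply: sq_cls_congr; rewrite add0r.
Qed.

Lemma sq_addN : left_inverse (sq_cls sq_sub0) sq_opp sq_add.
Proof.
move=> x; have [u [Su ->]] := sq_clsP x.
by rewrite sq_oppE sq_addE; apply: sq_cls_congr; rewrite addNr.
Qed.

HB.instance Definition _ :=
  GRing.isZmodule.Build sq sq_addA sq_addC sq_add0 sq_addN.

Lemma sq_clsD v w (Sv : sq_sub D v) (Sw : sq_sub D w) :
  sq_cls Sv + sq_cls Sw = sq_cls (sq_subD Sv Sw).
Proof. exact: sq_addE. Qed.

Lemma sq_cls_eq0 v (Sv : sq_sub D v) : sq_cls Sv = 0 <-> sq_rel D v.
Proof. by rewrite -[X in sq_rel D X]subr0; exact: sq_cls_eq. Qed.

End Subquotient.

Section Freyd.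
Variables (T : category) (P : T -> Prop).

(* An arrow d stands for the functor coker (mor(-, fr1) -> mor(-, fr0)) on P. *)
Record freyd_obj := FreydObj {
  fr1 : T;
  fr0 : T;
  frd : mor fr1 fr0;
  fr1P : P fr1;
  fr0P : P fr0 }.

Section Morphisms.
Variables X Y : freyd_obj.

(** The component f1 on relations is only required to exist: the map induced on cokernels depends on
    f alone. *)
Definition fr_sub (f : mor (fr0 X) (fr0 Y)) := exists f1, f ∘ frd X = frd Y ∘ f1.
Definition fr_rel (f : mor (fr0 X) (fr0 Y)) := exists s, f = frd Y ∘ s.

Lemma fr_subB f g : fr_sub f -> fr_sub g -> fr_sub (f - g).
Proof.
move=> [f1 ff1] [g1 gg1]; exists (f1 - g1).
by rewrite mcompBl ff1 gg1 mcompBr.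
Qed.

Lemma fr_rel0 : fr_rel 0.
Proof. by exists 0; rewrite mcompm0. Qed.

Lemma fr_relB f g : fr_rel f -> fr_rel g -> fr_rel (f - g).
Proof. by move=> [s ->] [t ->]; exists (s - t); rewrite mcompBr. Qed.

Lemma fr_rel_sub f : fr_rel f -> fr_sub f.
Proof. by move=> [s ->]; exists (s ∘ frd X); rewrite mcompA. Qed.

Definition fr_hom := Subquotient fr_subB fr_rel0 fr_relB fr_rel_sub.

End Morphisms.

Lemma fr_sub1 (X : freyd_obj) : fr_sub (idm (fr0 X) : mor (fr0 X) (fr0 X)).
Proof. by exists (idm _); rewrite mcomp1m mcompm1. Qed.

Lemma fr_subM (X Y Z : freyd_obj) (g : mor (fr0 Y) (fr0 Z))
    (f : mor (fr0 X) (fr0 Y)) : fr_sub g -> fr_sub f -> fr_sub (g ∘ f).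
Proof.
move=> [g1 gg1] [f1 ff1]; exists (g1 ∘ f1).
by rewrite -mcompA ff1 !mcompA gg1.
Qed.

Definition fr_cls (X Y : freyd_obj) (f : mor (fr0 X) (fr0 Y)) (Sf : fr_sub f) :
  sq (fr_hom X Y) := @sq_cls _ (fr_hom X Y) f Sf.

Definition fr_id (X : freyd_obj) : sq (fr_hom X X) := fr_cls (fr_sub1 X).

Definition fr_comp (X Y Z : freyd_obj) (g : sq (fr_hom Y Z))
    (f : sq (fr_hom X Y)) : sq (fr_hom X Z) :=
  fr_cls (fr_subM (sq_valP g) (sq_valP f)).

Lemma fr_compE (X Y Z : freyd_obj) (g : mor (fr0 Y) (fr0 Z))
    (f : mor (fr0 X) (fr0 Y)) (Sg : fr_sub g) (Sf : fr_sub f) :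
  fr_comp (fr_cls Sg) (fr_cls Sf) = fr_cls (fr_subM Sg Sf).
Proof.
apply/sq_cls_eq; set g' := sq_val _; set f' := sq_val _.
have [s gs] : fr_rel (g' - g) by exact: (@sq_val_rel _ (fr_hom Y Z)).
have [t ft] : fr_rel (f' - f) by exact: (@sq_val_rel _ (fr_hom X Y)).
(* From g' ∘ f' - g ∘ f = (g' - g) ∘ f' + g ∘ (f' - f), with g1 carrying the relation in the second
   term over to Z. *)
have [g1 gg1] := Sg; exists (s ∘ f' + g1 ∘ t).
by rewrite mcompDr !mcompA -gs -gg1 -mcompA -ft mcompBl mcompBr subrKA.
Qed.

Lemma fr_clsP (X Y : freyd_obj) (x : sq (fr_hom X Y)) :
  exists f (Sf : fr_sub f), x = fr_cls Sf.
Proof. exact: (@sq_clsP _ (fr_hom X Y) x). Qed.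

Lemma fr_cls_eq (X Y : freyd_obj) (f g : mor (fr0 X) (fr0 Y)) (Sf : fr_sub f)
    (Sg : fr_sub g) : fr_cls Sf = fr_cls Sg <-> exists s, f - g = frd Y ∘ s.
Proof. exact: (@sq_cls_eq _ (fr_hom X Y)). Qed.

Lemma fr_cls_congr (X Y : freyd_obj) (f g : mor (fr0 X) (fr0 Y))
    (Sf : fr_sub f) (Sg : fr_sub g) : f = g -> fr_cls Sf = fr_cls Sg.
Proof. by move=> fg; apply/fr_cls_eq; exists 0; rewrite fg subrr mcompm0. Qed.

Lemma fr_compA (X Y Z W : freyd_obj) (h : sq (fr_hom Z W)) (g : sq (fr_hom Y Z))
    (f : sq (fr_hom X Y)) : fr_comp h (fr_comp g f) = fr_comp (fr_comp h g) f.
Proof.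
have [h0 [Sh ->]] := fr_clsP h; have [g0 [Sg ->]] := fr_clsP g.
have [f0 [Sf ->]] := fr_clsP f.
by rewrite !fr_compE; apply: fr_cls_congr; rewrite mcompA.
Qed.

Lemma fr_comp1m (X Y : freyd_obj) (f : sq (fr_hom X Y)) :
  fr_comp (fr_id Y) f = f.
Proof.
have [f0 [Sf ->]] := fr_clsP f.
by rewrite fr_compE; apply: fr_cls_congr; rewrite mcomp1m.
Qed.

Lemma fr_compm1 (X Y : freyd_obj) (f : sq (fr_hom X Y)) :
  fr_comp f (fr_id X) = f.
Proof.
have [f0 [Sf ->]] := fr_clsP f.
by rewrite fr_compE; apply: fr_cls_congr; rewrite mcompm1.
Qed.

Lemma fr_clsD (X Y : freyd_obj) (f g : mor (fr0 X) (fr0 Y)) (Sf : fr_sub f)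
    (Sg : fr_sub g) (Sfg : fr_sub (f + g)) :
  fr_cls Sf + fr_cls Sg = fr_cls Sfg :> sq (fr_hom X Y).
Proof. by rewrite /fr_cls sq_clsD; exact: fr_cls_congr. Qed.

Lemma fr_compDl (X Y Z : freyd_obj) (g g' : sq (fr_hom Y Z))
    (f : sq (fr_hom X Y)) : fr_comp (g + g') f = fr_comp g f + fr_comp g' f.
Proof.
have [g0 [Sg ->]] := fr_clsP g; have [g1 [Sg' ->]] := fr_clsP g'.
have [f0 [Sf ->]] := fr_clsP f; have Sgg' := @sq_subD _ (fr_hom Y Z) _ _ Sg Sg'.
rewrite (fr_clsD Sg Sg' Sgg') !fr_compE.
rewrite (fr_clsD _ _ (@sq_subD _ (fr_hom X Z) _ _ (fr_subM Sg Sf) (fr_subM Sg' Sf))).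
by apply: fr_cls_congr; rewrite mcompDl.
Qed.

Lemma fr_compDr (X Y Z : freyd_obj) (g : sq (fr_hom Y Z))
    (f f' : sq (fr_hom X Y)) : fr_comp g (f + f') = fr_comp g f + fr_comp g f'.
Proof.
have [f0 [Sf ->]] := fr_clsP f; have [f1 [Sf' ->]] := fr_clsP f'.
have [g0 [Sg ->]] := fr_clsP g; have Sff' := @sq_subD _ (fr_hom X Y) _ _ Sf Sf'.
rewrite (fr_clsD Sf Sf' Sff') !fr_compE.
rewrite (fr_clsD _ _ (@sq_subD _ (fr_hom X Z) _ _ (fr_subM Sg Sf) (fr_subM Sg Sf'))).
by apply: fr_cls_congr; rewrite mcompDr.
Qed.

Definition freyd : category :=
  @Category freyd_obj (fun X Y => sq (fr_hom X Y)) fr_id fr_comp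
    fr_compA fr_comp1m fr_compm1 fr_compDl fr_compDr.

(* fr_cls, typed so that the composition and addition of freyd apply. *)
Definition fcl (X Y : freyd) (f : mor (fr0 X) (fr0 Y)) (Sf : fr_sub f) :
  mor X Y := fr_cls Sf.

Lemma fclP (X Y : freyd) (x : mor X Y) :
  exists f (Sf : fr_sub (f : mor (fr0 X) (fr0 Y))), x = fcl Sf.
Proof. exact: fr_clsP. Qed.

Lemma fcl_eq (X Y : freyd) (f g : mor (fr0 X) (fr0 Y)) (Sf : fr_sub f)
    (Sg : fr_sub g) : fcl Sf = fcl Sg <-> exists s, f - g = frd Y ∘ s.
Proof. exact: (@sq_cls_eq _ (fr_hom X Y)). Qed.

Lemma fcl_eq0 (X Y : freyd) (f : mor (fr0 X) (fr0 Y)) (Sf : fr_sub f) :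
  fcl Sf = 0 <-> exists s, f = frd Y ∘ s.
Proof. exact: (@sq_cls_eq0 _ (fr_hom X Y)). Qed.

Lemma fclM (X Y Z : freyd) (g : mor (fr0 Y) (fr0 Z))
    (f : mor (fr0 X) (fr0 Y)) (Sg : fr_sub g) (Sf : fr_sub f) :
  fcl Sg ∘ fcl Sf = fcl (fr_subM Sg Sf).
Proof. exact: fr_compE. Qed.

Lemma fcl_id (X : freyd) : idm X = fcl (fr_sub1 X).
Proof. by []. Qed.

Lemma fclD (X Y : freyd) (f g : mor (fr0 X) (fr0 Y)) (Sf : fr_sub f)
    (Sg : fr_sub g) (Sfg : fr_sub (f + g)) : fcl Sf + fcl Sg = fcl Sfg.
Proof. exact: fr_clsD. Qed.

Lemma fcl_congr (X Y : freyd) (f g : mor (fr0 X) (fr0 Y)) (Sf : fr_sub f)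
    (Sg : fr_sub g) : f = g -> fcl Sf = fcl Sg.
Proof. exact: fr_cls_congr. Qed.

End Freyd.

(** * Abelian structure of the Freyd category *)

Section FreydAbelian.
Variables (T : category) (P : T -> Prop).

Definition closed_zero := exists2 Z : T, is_zero_obj Z & P Z.

Definition closed_biproduct := forall A B : T, P A -> P B ->
  exists (S : T) (i1 : mor A S) (i2 : mor B S) (p1 : mor S A) (p2 : mor S B),
    is_biproduct i1 i2 p1 p2 /\ P S.

Definition weak_kernels := forall (A B : T) (f : mor A B), P A -> P B ->
  exists (K : T) (k : mor K A), [/\ P K, f ∘ k = 0 &
    forall (Q : T) (x : mor Q A), P Q -> f ∘ x = 0 -> exists y, k ∘ y = x].

Hypotheses (P0 : closed_zero) (PD : closed_biproduct) (PK : weak_kernels).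

Lemma weak_pullback (A B D : T) (f : mor A D) (g : mor B D) :
  P A -> P B -> P D ->
  exists (K : T) (a : mor K A) (b : mor K B), [/\ P K, f ∘ a = g ∘ b &
    forall (Q : T) (x : mor Q A) (y : mor Q B), P Q -> f ∘ x = g ∘ y ->
      exists z, a ∘ z = x /\ b ∘ z = y].
Proof.
move=> PA PB PD'.
have [S [i1 [i2 [p1 [p2 [[p1i1 p2i2 p2i1 p1i2 S1] PS]]]]]] := PD PA PB.
have [K [k [PK' fgk ku]]] := PK (f ∘ p1 - g ∘ p2) PS PD'.
exists K, (p1 ∘ k), (p2 ∘ k); split=> // [|Q x y PQ fgxy].
  by apply/eqP; rewrite -subr_eq0 !mcompA -mcompBl fgk.
have [|z kz] := ku Q (i1 ∘ x + i2 ∘ y) PQ.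
  rewrite mcompDr !mcompA !mcompBl -!mcompA !(mcompA p1) !(mcompA p2).
  by rewrite p1i1 p1i2 p2i1 p2i2 !mcomp0m !mcomp1m !mcompm0 subr0 sub0r fgxy subrr.
exists z; rewrite -!mcompA kz !mcompDr !mcompA p1i1 p1i2 p2i1 p2i2.
by rewrite !mcomp0m !mcomp1m addr0 add0r.
Qed.

Notation Fr := (freyd P).

Lemma freyd_zero : exists Z : Fr, is_zero_obj Z.
Proof.
have [Z [Z0 Z0'] PZ] := P0; exists (FreydObj (0 : mor Z Z) PZ PZ).
by split=> A f; have [g [Sg ->]] := fclP f; apply/fcl_eq0; exists 0;
  rewrite mcompm0; [exact: Z0|exact: Z0'].
Qed.

Lemma freyd_biproduct (X Y : Fr) : exists (S : Fr) (i1 : mor X S)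
  (i2 : mor Y S) (p1 : mor S X) (p2 : mor S Y), is_biproduct i1 i2 p1 p2.
Proof.
have [S1 [i1 [i2 [p1 [p2 [[p1i1 p2i2 p2i1 p1i2 S1E] PS1]]]]]] :=
  PD (fr1P X) (fr1P Y).
have [S0 [j1 [j2 [q1 [q2 [[q1j1 q2j2 q2j1 q1j2 S0E] PS0]]]]]] :=
  PD (fr0P X) (fr0P Y).
pose S : Fr := FreydObj (j1 ∘ frd X ∘ p1 + j2 ∘ frd Y ∘ p2) PS1 PS0.
have Sj1 : @fr_sub _ _ X S j1.
  exists i1; rewrite /= mcompDl -!mcompA p1i1 p2i1.
  by rewrite !mcompm0 addr0 mcompm1.
have Sj2 : @fr_sub _ _ Y S j2.
  exists i2; rewrite /= mcompDl -!mcompA p1i2 p2i2.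
  by rewrite !mcompm0 add0r mcompm1.
have Sq1 : @fr_sub _ _ S X q1.
  exists p1; rewrite /= mcompDr !mcompA q1j1 q1j2.
  by rewrite !mcomp0m addr0 mcomp1m.
have Sq2 : @fr_sub _ _ S Y q2.
  exists p2; rewrite /= mcompDr !mcompA q2j1 q2j2.
  by rewrite !mcomp0m add0r mcomp1m.
exists S, (fcl Sj1), (fcl Sj2), (fcl Sq1), (fcl Sq2); split.
- by rewrite fclM fcl_id; exact: fcl_congr.
- by rewrite fclM fcl_id; exact: fcl_congr.
- by rewrite fclM; apply/fcl_eq0; exists 0; rewrite mcompm0.
- by rewrite fclM; apply/fcl_eq0; exists 0; rewrite mcompm0.
- rewrite !fclM.
  have SS := @sq_subD _ (fr_hom S S) _ _ (fr_subM Sj1 Sq1) (fr_subM Sj2 Sq2).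
  by rewrite (fclD _ _ SS) fcl_id; exact: fcl_congr.
Qed.

(** The cokernel keeps the generators of Y and adds f to its relations. The last clause spells out
    in T what it means to vanish there, which the arguments on monomorphisms and epimorphisms
    need. *)
Lemma freyd_cokernel_data (X Y : Fr) (f : mor (fr0 X) (fr0 Y)) (Sf : fr_sub f) :
  exists (Q : Fr) (q : mor Y Q), is_cokernel (fcl Sf) q /\
    forall (Z : Fr) (g : mor (fr0 Z) (fr0 Y)) (Sg : fr_sub g),
      q ∘ fcl Sg = 0 -> exists s t, g = frd Y ∘ s + f ∘ t.
Proof.
have [S [i1 [i2 [p1 [p2 [[p1i1 p2i2 p2i1 p1i2 S1] PS]]]]]] := PD (fr1P Y) (fr0P X).
pose Q : Fr := FreydObj (frd Y ∘ p1 + f ∘ p2) PS (fr0P Y).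
have Sq : @fr_sub _ _ Y Q (idm (fr0 Y)).
  exists i1; rewrite mcomp1m /= mcompDl -!mcompA p1i1 p2i1 mcompm0 addr0.
  by rewrite mcompm1.
exists Q, (fcl Sq); split; last first.
  move=> Z g Sg; rewrite fclM => /fcl_eq0[s gs]; exists (p1 ∘ s), (p2 ∘ s).
  by rewrite -[LHS]mcomp1m gs /= mcompDl -!mcompA.
apply: cokernelI.
- apply: epi_of_coker0 => Z z; have [g [Sg ->]] := fclP z.
  by rewrite fclM => /fcl_eq0[s gs]; apply/fcl_eq0; exists s; rewrite -gs mcompm1.
- rewrite fclM; apply/fcl_eq0; exists i2 => /=.
  by rewrite mcomp1m mcompDl -!mcompA p1i2 p2i2 mcompm0 add0r mcompm1.
- move=> Z z; have [g [Sg ->]] := fclP z; have [g1 gg1] := Sg.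
  rewrite fclM => /fcl_eq0[s gs].
  have Sg' : @fr_sub _ _ Q Z g.
    exists (g1 ∘ p1 + s ∘ p2).
    by rewrite /= !mcompDr !mcompA gg1 gs.
  by exists (fcl Sg'); rewrite fclM; apply: fcl_congr; rewrite mcompm1.
Qed.

(* The kernel of f is the weak pullback of its arrow along the weak pullback of
   f and frd Y. *)
Lemma freyd_kernel_data (X Y : Fr) (f : mor (fr0 X) (fr0 Y)) (Sf : fr_sub f) :
  exists (K : Fr) (k : mor (fr0 K) (fr0 X)) (k' : mor (fr0 K) (fr1 Y))
    (Sk : fr_sub k),
  [/\ f ∘ k = frd Y ∘ k', is_kernel (fcl Sf) (fcl Sk) &
    forall (Q : T) (x : mor Q (fr0 X)) (y : mor Q (fr1 Y)), P Q ->
      f ∘ x = frd Y ∘ y -> exists z, k ∘ z = x].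
Proof.
have [K0 [k [k' [PK0 kk' K0u]]]] := weak_pullback f (frd Y) (fr0P X) (fr1P Y) (fr0P Y).
have [K1 [a [b [PK1 ab K1u]]]] := weak_pullback k (frd X) PK0 (fr1P X) (fr0P X).
pose K : Fr := FreydObj a PK1 PK0.
have Sk : @fr_sub _ _ K X k by exists b.
exists K, k, k', Sk; split=> // [|Q x y PQ fxy]; last first.
  by have [z [kz _]] := K0u Q x y PQ fxy; exists z.
apply: kernelI.
- apply: mono_of_ker0 => Z z; have [g [Sg ->]] := fclP z.
  rewrite fclM => /fcl_eq0[s gs]; apply/fcl_eq0.
  by have [t [at_ _]] := K1u _ _ _ (fr0P Z) gs; exists t.
- by rewrite fclM; apply/fcl_eq0; exists k'.
- move=> Z z; have [g [Sg ->]] := fclP z; have [g1 gg1] := Sg.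
  rewrite fclM => /fcl_eq0[s fgs].
  have [y [ky _]] := K0u _ _ _ (fr0P Z) fgs.
  have [|t [at_ _]] := K1u _ (y ∘ frd Z) g1 (fr1P Z); first by rewrite mcompA ky.
  have Sy : @fr_sub _ _ Z K y by exists t.
  by exists (fcl Sy); rewrite fclM; exact: fcl_congr.
Qed.

Lemma freyd_mono_kernel (X Y : Fr) (m : mor X Y) : is_mono m ->
  exists (Q : Fr) (q : mor Y Q), is_kernel q m.
Proof.
have [f [Sf ->]] := fclP m => fm.
have [Q [q [fq qu]]] := freyd_cokernel_data Sf.
exists Q, q; apply: kernelI => //; first exact: fq.1.
move=> Z z; have [g [Sg ->]] := fclP z; have [g1 gg1] := Sg.
move=> /qu[s [t gE]].
have [O [O0 O0'] PO] := P0.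
(* To be a morphism from Z to X, t must send relations to relations. W is the free object on the
   relations of Z; t ∘ [frd Z] defines a morphism on it that f kills, so it vanishes because f is
   mono. *)
pose W : Fr := FreydObj (0 : mor O (fr1 Z)) PO (fr1P Z).
have Sw : @fr_sub _ _ W X (t ∘ frd Z).
  by exists 0; rewrite /= !mcompm0.
have /fcl_eq0[r wr] : fcl Sw = 0.
  apply: (mono0 fm); rewrite fclM; apply/fcl_eq0.
  exists (g1 - s ∘ frd Z); rewrite mcompBr -gg1 gE mcompDl !mcompA.
  by rewrite addrAC subrr add0r.
have Sy : @fr_sub _ _ Z X t by exists r.
exists (fcl Sy); rewrite fclM; apply/fcl_eq; exists (- s).
by rewrite gE mcompNr opprD addrCA subrr addr0.
Qed.

(** The cokernel map of an epimorphism is zero, so it kills the identity of Y, and the explicit form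
    of this vanishing is the claim. *)
Lemma freyd_epi_split (X Y : Fr) (f : mor (fr0 X) (fr0 Y)) (Sf : fr_sub f) :
  is_epi (fcl Sf) -> exists s t, idm (fr0 Y) = frd Y ∘ s + f ∘ t.
Proof.
move=> fe; have [Q [q [fq qu]]] := freyd_cokernel_data Sf.
apply: (qu Y _ (fr_sub1 Y)).
by rewrite (epi0 fe fq.1) mcomp0m.
Qed.

Lemma freyd_epi_cokernel (X Y : Fr) (e : mor X Y) : is_epi e ->
  exists (K : Fr) (k : mor K X), is_cokernel k e.
Proof.
have [f [Sf ->]] := fclP e => fe; have [f1 ff1] := Sf.
have [s [t st]] := freyd_epi_split fe.
have [K [k [k' [Sk [fkk' fk Ku]]]]] := freyd_kernel_data Sf.
exists K, (fcl Sk); apply: cokernelI => //; first exact: fk.1.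
move=> Z z; have [g [Sg ->]] := fclP z; have [g1 gg1] := Sg.
rewrite fclM => /fcl_eq0[r gkr].
have ftE : f ∘ t = idm _ - frd Y ∘ s by rewrite st addrAC subrr add0r.
(* The factorization through e is g ∘ t. Both t ∘ [frd Y] and idm - t ∘ f become relations under f,
   so they factor through k: u shows that g ∘ t respects relations, v that it factors g. *)
have [|u ku] := Ku _ (t ∘ frd Y) (idm _ - s ∘ frd Y) (fr1P Y).
  by rewrite mcompA ftE mcompBl mcompBr mcompm1 mcomp1m mcompA.
have [|v kv] := Ku _ (idm _ - t ∘ f) (s ∘ f) (fr0P X).
  by rewrite mcompBr mcompA ftE mcompBl mcompm1 mcomp1m opprB addrC subrK mcompA.
have Sy : @fr_sub _ _ Y Z (g ∘ t).
  by exists (r ∘ u); rewrite -mcompA -ku !mcompA gkr.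
exists (fcl Sy); rewrite fclM; apply/fcl_eq; exists (- (r ∘ v)).
rewrite mcompNr mcompA -gkr -(mcompA g k) kv mcompBr mcompm1 opprB.
by rewrite mcompA.
Qed.

Lemma freyd_abelian : is_abelian Fr.
Proof.
split.
- split; [exact: freyd_zero|exact: freyd_biproduct].
- move=> X Y x; have [f [Sf ->]] := fclP x.
  by have [K [k [k' [Sk [_ fk _]]]]] := freyd_kernel_data Sf; exists K, (fcl Sk).
- move=> X Y x; have [f [Sf ->]] := fclP x.
  by have [Q [q [fq _]]] := freyd_cokernel_data Sf; exists Q, q.
- exact: freyd_mono_kernel.
- exact: freyd_epi_cokernel.
Qed.

End FreydAbelian.

(** * Suspension of the Freyd category *)

Section FreydSuspension.
Variables (T : category) (P : T -> Prop) (S : functor T T).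
Hypotheses (autS : is_automorphism S) (PS : forall A, P (S A) <-> P A).

Notation Fr := (freyd P).

Definition freyd_susp_obj (X : Fr) : Fr :=
  FreydObj (fmap S (frd X)) ((PS _).2 (fr1P X)) ((PS _).2 (fr0P X)).

Lemma fr_subS (X Y : Fr) (f : mor (fr0 X) (fr0 Y)) : fr_sub f ->
  @fr_sub _ _ (freyd_susp_obj X) (freyd_susp_obj Y) (fmap S f).
Proof. by move=> [f1 ff1]; exists (fmap S f1); rewrite /= -!fmapM ff1. Qed.

Definition freyd_susp_map (X Y : Fr) (f : mor X Y) :
    mor (freyd_susp_obj X) (freyd_susp_obj Y) :=
  fcl (fr_subS (@sq_valP _ (fr_hom X Y) f)).

Lemma freyd_susp_cl (X Y : Fr) (f : mor (fr0 X) (fr0 Y)) (Sf : fr_sub f) :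
  freyd_susp_map (fcl Sf) = fcl (fr_subS Sf).
Proof.
apply/fcl_eq; have [s fs] : fr_rel (sq_val (fcl Sf) - f).
  exact: (@sq_val_rel _ (fr_hom X Y)).
by exists (fmap S s); rewrite -fmapB fs fmapM.
Qed.

Lemma freyd_susp1 (X : Fr) : freyd_susp_map (idm X) = idm (freyd_susp_obj X).
Proof. by rewrite fcl_id freyd_susp_cl; apply: fcl_congr; rewrite fmap1. Qed.

Lemma freyd_suspM (X Y Z : Fr) (g : mor Y Z) (f : mor X Y) :
  freyd_susp_map (g ∘ f) = freyd_susp_map g ∘ freyd_susp_map f.
Proof.
have [g0 [Sg ->]] := fclP g; have [f0 [Sf ->]] := fclP f.
by rewrite fclM !freyd_susp_cl fclM; apply: fcl_congr; rewrite fmapM.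
Qed.

Lemma freyd_suspD (X Y : Fr) (f g : mor X Y) :
  freyd_susp_map (f + g) = freyd_susp_map f + freyd_susp_map g.
Proof.
have [g0 [Sg ->]] := fclP g; have [f0 [Sf ->]] := fclP f.
have Sfg := @sq_subD _ (fr_hom X Y) _ _ Sf Sg.
rewrite (fclD Sf Sg Sfg) !freyd_susp_cl.
have SSfg : @fr_sub _ _ (freyd_susp_obj X) (freyd_susp_obj Y)
    (fmap S f0 + fmap S g0) by rewrite -fmapD; exact: fr_subS.
by rewrite (fclD _ _ SSfg); apply: fcl_congr; rewrite fmapD.
Qed.

Definition freyd_susp : functor Fr Fr :=
  Functor freyd_susp1 freyd_suspM freyd_suspD.

Lemma inj_surj_bijective (U V : Type) (f : U -> V) :
  injective f -> (forall v, exists u, f u = v) -> bijective f.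
Proof.
move=> fi fs; pose g v := projT1 (cid (fs v)).
have fK : cancel g f by move=> v; exact: (projT2 (cid (fs v))).
by exists g => // u; apply: fi; rewrite fK.
Qed.

(** Proof irrelevance makes every proof of u = u equal to [erefl]. *)
Lemma existT_inj (U : Type) (V : U -> Type) (u : U) (v v' : V u) :
  existT V u v = existT V u v' -> v = v'.
Proof.
by move=> E; have := projT2_eq E; rewrite (Prop_irrelevance (projT1_eq E) erefl).
Qed.

(** Bijectivity of the suspension on objects calls for equalities between objects; this packaging
    reduces them to equalities of dependent pairs. *)
Definition arrow_of (X : Fr) : {AB : T * T & mor AB.1 AB.2} :=
  existT (fun AB : T * T => mor AB.1 AB.2) (fr1 X, fr0 X) (frd X).

Lemma arrow_of_inj : injective arrow_of.
Proof.
move=> [A B d PA PB] [A' B' d' PA' PB'] E.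
have [/= EA EB] := congr1 (@projT1 _ _) E; subst A' B'.
rewrite /arrow_of /= in E; rewrite (existT_inj E).
by rewrite (Prop_irrelevance PA PA') (Prop_irrelevance PB PB').
Qed.

Lemma freyd_susp_obj_inj : injective freyd_susp_obj.
Proof.
move=> [A B d PA PB] [A' B' d' PA' PB'] /(congr1 arrow_of) E.
apply: arrow_of_inj; have [/= EA EB] := congr1 (@projT1 _ _) E.
have ? := bij_inj autS.1 EA; have ? := bij_inj autS.1 EB; subst A' B'.
by rewrite /arrow_of /= in E *; rewrite (aut_inj autS (existT_inj E)).
Qed.

Lemma freyd_susp_obj_surj (Y : Fr) : exists X, freyd_susp_obj X = Y.
Proof.
case: Y => A B d PA PB; have [A' EA] := aut_obj autS A.
have [B' EB] := aut_obj autS B; subst A B; have [d' Ed] := aut_full autS d.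
exists (FreydObj d' ((PS _).1 PA) ((PS _).1 PB)); apply: arrow_of_inj.
by rewrite /arrow_of /= Ed.
Qed.

Lemma freyd_susp_map_inj (X Y : Fr) : injective (@freyd_susp_map X Y).
Proof.
move=> f g; have [f0 [Sf ->]] := fclP f; have [g0 [Sg ->]] := fclP g.
rewrite !freyd_susp_cl => /fcl_eq[s]; have [s' <-] := aut_full autS s.
by rewrite -fmapB -fmapM => /(aut_inj autS) fgs; apply/fcl_eq; exists s'.
Qed.

Lemma freyd_susp_map_surj (X Y : Fr)
    (g : mor (freyd_susp_obj X) (freyd_susp_obj Y)) :
  exists f, freyd_susp_map f = g.
Proof.
have [g0 [Sg ->]] := fclP g; have [f0 Ef] := aut_full autS (g0 : mor (S _) (S _)).
have Sf : @fr_sub _ _ X Y f0.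
  have [g1] := Sg; have [f1 <-] := aut_full autS (g1 : mor (S _) (S _)).
  by rewrite -Ef /= -!fmapM => /(aut_inj autS) ff1; exists f1.
by exists (fcl Sf); rewrite freyd_susp_cl; exact: fcl_congr.
Qed.

Lemma freyd_susp_aut : is_automorphism freyd_susp.
Proof.
split=> [|X Y]; apply: inj_surj_bijective.
- exact: freyd_susp_obj_inj.
- exact: freyd_susp_obj_surj.
- exact: freyd_susp_map_inj.
- exact: freyd_susp_map_surj.
Qed.

End FreydSuspension.

(** * The Freyd category of the ideal projectives *)

Section IdealFreyd.
Variables (T : triangulated) (I : ideal T).
Hypotheses (hI : homological_ideal I) (enI : enough_ideal_projectives I).

Notation P := (ideal_projective I).

(** The hypothesis that I is a homological ideal enters the Freyd construction through this
    invariance. *)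
Lemma ideal_susp (A B : T) (f : mor A B) : in_ideal I (fmap susp f) <-> in_ideal I f.
Proof.
have [C [F [[_ stF] [IF FI]]]] := hI.
have stF' := nat_iso_sym stF.
split=> [/IF|/IF] /= Ff0; apply: FI => /=; last first.
  by apply: (nat_iso_fmap0 stF'); rewrite /= Ff0 fmap0.
apply: (aut_inj (susp_aut C)); rewrite fmap0.
exact: (nat_iso_fmap0 stF).
Qed.

Lemma ideal_projective_susp (A : T) : P (susp A) <-> P A.
Proof.
split=> PA X Y f If x; last first.
  have [X' EX] := aut_obj (susp_aut T) X; have [Y' EY] := aut_obj (susp_aut T) Y.
  subst X Y; have [f' Ef] := aut_full (susp_aut T) f.
  have [x' Ex] := aut_full (susp_aut T) x; subst f x.
  by rewrite -fmapM PA ?fmap0 //; apply/ideal_susp.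
apply: (aut_inj (susp_aut T)); rewrite fmap0 fmapM; apply: PA.
exact/ideal_susp.
Qed.

(** In the triangle on p, the cone map g lies in I. Morphisms from I-projectives die under g and so
    lift through p; morphisms vanishing on p factor through g and so lie in I. *)
Lemma ideal_cover (A : T) : exists (Q : T) (p : mor Q A), [/\ P Q,
  forall (L : T) (x : mor L A), P L -> exists y, p ∘ y = x &
  forall (B : T) (f : mor A B), f ∘ p = 0 -> in_ideal I f].
Proof.
have [Q [p [PQ [D [g [h [pgh Ig]]]]]]] := enI A.
exists Q, p; split=> // [L x PL|B f /(tri_weak_cokernel pgh)[c <-]].
  by apply: (tri_weak_kernel pgh); exact: PL.
exact: ideal_compl.
Qed.

Lemma ideal_projective_zero : closed_zero P.
Proof.
have [Z Z0] := ex_zero_obj T; exists Z => // X Y f _ x.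
by rewrite (Z0.2 _ x) mcompm0.
Qed.

Lemma ideal_projective_biproduct : closed_biproduct P.
Proof.
move=> A B PA PB; have [_ /(_ A B)] := stable_is_additive T.
move=> [S [i1 [i2 [p1 [p2 SE]]]]]; exists S, i1, i2, p1, p2; split=> //.
have [_ _ _ _ S1] := SE; move=> X Y f If x.
rewrite -(mcompm1 x) -S1 !mcompDr !mcompA -!(mcompA f x).
by rewrite (PA _ _ f If (x ∘ i1)) (PB _ _ f If (x ∘ i2)) !mcomp0m addr0.
Qed.

Lemma ideal_weak_kernel (A B : T) (f : mor A B) :
  exists (K : T) (k : mor K A), [/\ P K, f ∘ k = 0 &
    forall (Q : T) (x : mor Q A), P Q -> f ∘ x = 0 -> exists y, k ∘ y = x].
Proof.
have [K [k [h kfh]]] := tri_cocone f; have [Q [p [PQ pu _]]] := ideal_cover K.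
exists Q, (k ∘ p); split=> // [|L x PL /(tri_weak_kernel kfh)[y <-]].
  by rewrite mcompA (tri_comp0 kfh) mcomp0m.
by have [z <-] := pu _ y PL; exists z; rewrite mcompA.
Qed.

Lemma ideal_projective_weak_kernels : weak_kernels P.
Proof. by move=> A B f _ _; exact: ideal_weak_kernel. Qed.

Let abFr : is_abelian (freyd P) :=
  freyd_abelian ideal_projective_zero ideal_projective_biproduct
    ideal_projective_weak_kernels.

Definition ideal_freyd : stable_abelian :=
  @StableAbelian (@StableAdditive (freyd P) (let: And5 h _ _ _ _ := abFr in h)
    (freyd_susp ideal_projective_susp)
    (freyd_susp_aut (susp_aut T) ideal_projective_susp)) abFr.

(** Only lifting properties are recorded, so that the suspension of a resolution is again one and
    can be compared with the chosen one. The field [res_ideal] bounds the kernel of the resulting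
    functor by I. *)
Record resolution (A : T) := Resolution {
  res1 : T;
  res0 : T;
  res_d : mor res1 res0;
  res_p : mor res0 A;
  res1P : P res1;
  res0P : P res0;
  res_pd : res_p ∘ res_d = 0;
  res_lift0 : forall (Q : T) (x : mor Q A), P Q -> exists y, res_p ∘ y = x;
  res_lift1 : forall (Q : T) (x : mor Q res0), P Q -> res_p ∘ x = 0 ->
    exists y, res_d ∘ y = x;
  res_ideal : forall (B : T) (f : mor A B), f ∘ res_p = 0 -> in_ideal I f }.

Arguments res1P {A} r.
Arguments res0P {A} r.

Lemma ex_resolution (A : T) : inhabited (resolution A).
Proof.
have [P0 [p [PP0 pu pI]]] := ideal_cover A.
have [P1 [d [PP1 pd du]]] := ideal_weak_kernel p.
by exists; exact: (Resolution PP1 PP0 pd pu du pI).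
Qed.

Definition res (A : T) : resolution A := inhabited_witness (ex_resolution A).

Lemma susp_resolution_lift0 (A : T) (R : resolution A) (Q : T)
  (x : mor Q (susp A)) : P Q -> exists y, fmap susp (res_p R) ∘ y = x.
Proof.
have [Q' EQ] := aut_obj (susp_aut T) Q; subst Q.
have [x' <-] := aut_full (susp_aut T) x.
move=> /ideal_projective_susp PQ; have [y <-] := res_lift0 R x' PQ.
by exists (fmap susp y); rewrite fmapM.
Qed.

Lemma susp_resolution_lift1 (A : T) (R : resolution A) (Q : T)
    (x : mor Q (susp (res0 R))) :
  P Q -> fmap susp (res_p R) ∘ x = 0 -> exists y, fmap susp (res_d R) ∘ y = x.
Proof.
have [Q' EQ] := aut_obj (susp_aut T) Q; subst Q.
have [x' <-] := aut_full (susp_aut T) x.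
move=> /ideal_projective_susp PQ; rewrite -fmapM -(fmap0 susp).
move=> /(aut_inj (susp_aut T)) px0.
by have [y <-] := res_lift1 PQ px0; exists (fmap susp y); rewrite fmapM.
Qed.

Lemma susp_resolution_ideal (A : T) (R : resolution A) (B : T)
  (f : mor (susp A) B) : f ∘ fmap susp (res_p R) = 0 -> in_ideal I f.
Proof.
have [B' EB] := aut_obj (susp_aut T) B; subst B.
have [f' <-] := aut_full (susp_aut T) f.
rewrite -fmapM -(fmap0 susp) => /(aut_inj (susp_aut T)) fp0.
exact/ideal_susp/(res_ideal fp0).
Qed.

Lemma susp_resolution_pd (A : T) (R : resolution A) :
  fmap susp (res_p R) ∘ fmap susp (res_d R) = 0.
Proof. by rewrite -fmapM res_pd fmap0. Qed.

Definition susp_resolution (A : T) (R : resolution A) : resolution (susp A) :=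
  Resolution ((ideal_projective_susp _).2 (res1P R))
    ((ideal_projective_susp _).2 (res0P R)) (susp_resolution_pd R)
    (@susp_resolution_lift0 A R) (@susp_resolution_lift1 A R)
    (@susp_resolution_ideal A R).

(** A presentation of the functor mor(-, A) restricted to the I-projectives. *)
Definition res_obj (A : T) (R : resolution A) : freyd P :=
  FreydObj (res_d R) (res1P R) (res0P R).

Section Comparison.
Variables (A B : T) (R : resolution A) (S : resolution B).

Lemma comparison_sub (f : mor A B) (f0 : mor (res0 R) (res0 S)) :
  res_p S ∘ f0 = f ∘ res_p R -> @fr_sub _ _ (res_obj R) (res_obj S) f0.
Proof.
move=> pf0; have [|y dy] := res_lift1 (x := f0 ∘ res_d R) (res1P R) (r := S).
  by rewrite mcompA pf0 -mcompA res_pd mcompm0.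
by exists y.
Qed.

Lemma ex_comparison (f : mor A B) :
  exists f0 : mor (res0 R) (res0 S), res_p S ∘ f0 = f ∘ res_p R.
Proof. exact: res_lift0 (res0P R). Qed.

Definition comparison (f : mor A B) : mor (res_obj R) (res_obj S) :=
  fcl (comparison_sub (projT2 (cid (ex_comparison f)))).

Lemma comparisonE (f : mor A B) (f0 : mor (res0 R) (res0 S))
    (Sf : @fr_sub _ _ (res_obj R) (res_obj S) f0) :
  res_p S ∘ f0 = f ∘ res_p R -> comparison f = fcl Sf.
Proof.
move=> pf0; apply/fcl_eq; case: (cid _) => g0 /= pg0.
have [|y dy] := res_lift1 (x := g0 - f0) (res0P R) (r := S).
  by rewrite mcompBr pg0 pf0 subrr.
by exists y.
Qed.

Lemma comparison_cl (f : mor A B) : exists (f0 : mor (res0 R) (res0 S))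
    (Sf : @fr_sub _ _ (res_obj R) (res_obj S) f0),
  comparison f = fcl Sf /\ res_p S ∘ f0 = f ∘ res_p R.
Proof.
have [f0 pf0] := ex_comparison f.
by exists f0, (comparison_sub pf0); split=> //; exact: comparisonE.
Qed.

Lemma comparisonD (f g : mor A B) :
  comparison (f + g) = comparison f + comparison g.
Proof.
have [f0 [Sf [-> pf]]] := comparison_cl f.
have [g0 [Sg [-> pg]]] := comparison_cl g.
have Sfg := @sq_subD _ (fr_hom (res_obj R) (res_obj S)) _ _ Sf Sg.
rewrite (fclD Sf Sg Sfg); apply: comparisonE.
by rewrite mcompDr pf pg mcompDl.
Qed.

Lemma comparison_eq0 (f : mor A B) : comparison f = 0 <-> in_ideal I f.
Proof.
have [f0 [Sf [-> pf]]] := comparison_cl f.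
split=> [/fcl_eq0[s fs]|If].
  by apply: (res_ideal (r := R)); rewrite -pf fs /= mcompA res_pd mcomp0m.
apply/fcl_eq0; have [|y dy] := res_lift1 (x := f0) (res0P R) (r := S).
  by rewrite pf; exact: (res0P R).
by exists y.
Qed.

End Comparison.

Lemma comparisonM (A B D : T) (R : resolution A) (S : resolution B)
    (U : resolution D) (g : mor B D) (f : mor A B) :
  comparison R U (g ∘ f) = comparison S U g ∘ comparison R S f.
Proof.
have [f0 [Sf [-> pf]]] := comparison_cl R S f.
have [g0 [Sg [-> pg]]] := comparison_cl S U g.
by rewrite fclM; apply: comparisonE; rewrite mcompA pg -[LHS]mcompA pf mcompA.
Qed.

Lemma comparison1 (A : T) (R : resolution A) :
  comparison R R (idm A) = idm (res_obj R).
Proof. by rewrite fcl_id; apply: comparisonE; rewrite mcompm1 mcomp1m. Qed.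

Lemma comparison_iso (A : T) (R S : resolution A) :
  comparison S R (idm A) ∘ comparison R S (idm A) = idm (res_obj R).
Proof. by rewrite -comparisonM mcomp1m comparison1. Qed.

Lemma comparison_natural (A B : T) (R R' : resolution A) (S S' : resolution B)
    (f : mor A B) : comparison S S' (idm B) ∘ comparison R S f =
                    comparison R' S' f ∘ comparison R R' (idm A).
Proof. by rewrite -!comparisonM mcomp1m mcompm1. Qed.

Lemma comparison_susp (A B : T) (R : resolution A) (S : resolution B)
    (f : mor A B) :
  freyd_susp_map ideal_projective_susp (comparison R S f) =
  comparison (susp_resolution R) (susp_resolution S) (fmap susp f).
Proof.
have [f0 [Sf [-> pf]]] := comparison_cl R S f.
rewrite freyd_susp_cl; apply: esym.
apply: (@comparisonE _ _ (susp_resolution R) (susp_resolution S) _ (fmap susp f0)).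
by rewrite /= -!fmapM pf.
Qed.

Definition ideal_yoneda : functor T ideal_freyd :=
  @Functor T ideal_freyd (fun A => res_obj (res A))
    (fun A B f => comparison (res A) (res B) f)
    (fun A => comparison1 (res A))
    (fun A B D g f => comparisonM (res A) (res B) (res D) g f)
    (fun A B f g => comparisonD (res A) (res B) f g).

Notation h := ideal_yoneda.

Lemma ideal_yoneda_ker (A B : T) (f : mor A B) :
  fmap h f = 0 <-> in_ideal I f.
Proof. exact: comparison_eq0. Qed.

Lemma ideal_yoneda_stable : stable_functor h.
Proof.
exists (fun A => comparison (res (susp A)) (susp_resolution (res A)) (idm _)).
split=> [A|A B f].
  exists (comparison (susp_resolution (res A)) (res (susp A)) (idm _)).
  split; first exact: (comparison_iso (res (susp A)) (susp_resolution (res A))).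
  exact: (comparison_iso (susp_resolution (res A)) (res (susp A))).
apply: etrans (comparison_natural (res (susp A)) (susp_resolution (res A))
  (res (susp B)) (susp_resolution (res B)) (fmap susp f)) _.
by rewrite -comparison_susp.
Qed.

(** The augmentation p of the resolution of L has a section sg, so h L is a representable functor: a
    morphism out of it is determined by its composite with sg. *)
Lemma ideal_projective_adapted (L : T) : P L -> adapted h L.
Proof.
move=> PL; have [sg psg] := res_lift0 (res L) (idm L) PL.
set p := res_p (res L) in psg.
(* Since p kills idm - sg ∘ p, this difference factors through the relations of L, which f0 sends to
   relations. *)
have lift (B : T) (R : resolution B) (f0 : mor (res0 (res L)) (res0 R)) :
    @fr_sub _ _ (res_obj (res L)) (res_obj R) f0 ->
    exists s, f0 - f0 ∘ sg ∘ p = res_d R ∘ s.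
  move=> [f1 /= ff1]; have [|y dy] := res_lift1 (x := idm _ - sg ∘ p) (res0P (res L)).
    by rewrite mcompBr mcompm1 mcompA psg mcomp1m subrr.
  exists (f1 ∘ y).
  by rewrite [RHS]mcompA -ff1 -[RHS]mcompA dy mcompBr mcompm1 mcompA.
split.
- move=> X Y e f; have [e0 [Se ->]] := fclP e; have [f0 [Sf ->]] := fclP f.
  move=> ee; have [|s [t st]] := freyd_epi_split _ ee.
    exact: ideal_projective_biproduct.
  have [f1 ff1] := Sf.
  have [|y dy] := res_lift1 (x := idm _ - sg ∘ p) (res0P (res L)).
    by rewrite mcompBr mcompm1 mcompA psg mcomp1m subrr.
  (* The composite t ∘ f0 alone need not respect relations; inserting sg ∘ p does not change the
     class of f0 and kills the relations of L. *)
  have Sg : @fr_sub _ _ (res_obj (res L)) X (t ∘ f0 ∘ sg ∘ p).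
    by exists 0; rewrite -[LHS]mcompA [p ∘ _]res_pd !mcompm0.
  exists (fcl Sg); rewrite [LHS]fclM; apply/fcl_eq.
  exists (- (s ∘ f0 ∘ sg ∘ p) - f1 ∘ y).
  have etE : e0 ∘ t = idm _ - frd Y ∘ s by rewrite st addrAC subrr add0r.
  rewrite mcompBr mcompNr !mcompA -ff1 etE -(mcompA f0) [_ ∘ y]dy.
  rewrite !mcompBl mcomp1m mcompBr mcompm1 !mcompA opprB.
  by rewrite addrCA addrA.
- move=> B f; have [f0 [Sf ->]] := fclP f.
  exists (res_p (res B) ∘ f0 ∘ sg); apply: comparisonE.
  have [s fs] := lift _ _ _ Sf; apply/eqP; rewrite -subr_eq0 -!mcompA -mcompBr.
  by rewrite !mcompA fs mcompA res_pd mcomp0m.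
- move=> B g /ideal_yoneda_ker Ig.
  by rewrite -(mcompm1 g); exact: PL.
Qed.

(** Each X is a quotient of h of its own object of generators, by the class of the augmentation; the
    section sg makes it epi. *)
Lemma ideal_yoneda_enough : enough_adapted h.
Proof.
move=> X; have [sg psg] := res_lift0 (res (fr0 X)) (idm _) (fr0P X).
have Sp : @fr_sub _ _ (res_obj (res (fr0 X))) X (res_p (res (fr0 X))).
  by exists 0; rewrite /= res_pd mcompm0.
exists (fr0 X), (fcl Sp); split; first exact: ideal_projective_adapted (fr0P X).
apply: epi_of_coker0 => Y y; have [g [Sg ->]] := fclP y.
rewrite [LHS]fclM => /fcl_eq0[s gs]; apply/fcl_eq0; exists (s ∘ sg).
by rewrite mcompA -gs -mcompA psg mcompm1.
Qed.

Lemma ideal_yoneda_homological : homological h.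
Proof.
move=> X Y Z f g k fgk; apply: (exact_atI abFr) => [|W x gx0].
  by rewrite -[LHS](fmapM h) (tri_comp0 fgk); exact: fmap0.
(* After covering the test object by h L, exactness becomes the weak kernel property of the triangle
   in T. *)
have [L [e [aL ee]]] := ideal_yoneda_enough W; have [_ fuL faL] := aL.
have [x' hx'] := fuL _ (x ∘ e).
have [|y fy] := tri_weak_kernel fgk (x := x').
  apply: faL; rewrite fmapM hx'.
  by rewrite [LHS](@mcompA (freyd P)) gx0 mcomp0m.
exists (h L), e, (fmap h y); split=> //.
by rewrite -[LHS](fmapM h) fy.
Qed.

End IdealFreyd.

(** * The partial left adjoint *)

Section PartialAdjoint.
Variables (T C : category) (F : functor T C).

Definition runit (A : C) (r : representation F A) : mor A (F (rep_obj r)) :=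
  rep r _ (idm _).

Lemma rep_runit (A : C) (r : representation F A) (B : T) (g : mor (rep_obj r) B) :
  rep r B g = fmap F g ∘ runit r.
Proof. by rewrite -rep_nat mcompm1. Qed.

Lemma runit_inj (A : C) (r : representation F A) (B : T)
    (g g' : mor (rep_obj r) B) :
  fmap F g ∘ runit r = fmap F g' ∘ runit r -> g = g'.
Proof. by rewrite -!rep_runit => /(can_inj (@repK _ _ _ _ r B)). Qed.

Lemma runit_surj (A : C) (r : representation F A) (B : T) (f : mor A (F B)) :
  exists g, fmap F g ∘ runit r = f.
Proof. by exists (rep_inv r f); rewrite -rep_runit rep_invK. Qed.

(** By [rep_runit] the representing bijection is F followed by precomposition with the unit; if the
    unit is invertible, F itself is bijective. *)
Lemma runit_iso_adapted (A : C) (r : representation F A) :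
  projective A -> is_iso (runit r) -> adapted F (rep_obj r).
Proof.
move=> pA ur; split; first exact: projective_iso ur pA.
  move=> B f; have [g gE] := runit_surj r (f ∘ runit r).
  by exists g; apply: (iso_epi ur).
move=> B g Fg0; apply: (runit_inj (r := r)).
by rewrite Fg0 fmap0 !mcomp0m.
Qed.

Section AdaptedRepresentation.
Variables (A : C) (L : T) (u : mor A (F L)).
Hypotheses (aL : adapted F L) (uI : is_iso u).

Definition adapted_rep (B : T) (g : mor L B) : mor A (F B) := fmap F g ∘ u.

Lemma adapted_rep_additive (B : T) :
  {morph @adapted_rep B : f g / f - g}.
Proof. by move=> f g; rewrite /adapted_rep fmapB mcompBl. Qed.

HB.instance Definition _ (B : T) := GRing.isZmodMorphism.Build
  (mor L B) (mor A (F B)) (@adapted_rep B) (@adapted_rep_additive B).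

Lemma adapted_rep_surj (B : T) (f : mor A (F B)) : exists g, adapted_rep g = f.
Proof.
have [v [vu uv]] := uI; have [_ fuL _] := aL.
have [g gE] := fuL B (f ∘ v); exists g.
by rewrite /adapted_rep gE -mcompA vu mcompm1.
Qed.

Lemma adapted_rep_inj (B : T) : injective (@adapted_rep B).
Proof.
move=> g g' /(iso_epi uI) FE; have [_ _ faL] := aL.
by apply/eqP; rewrite -subr_eq0; apply/eqP/faL; rewrite fmapB FE subrr.
Qed.

Lemma adapted_ladj_defined : ladj_defined F A.
Proof.
pose inv B f := projT1 (cid (@adapted_rep_surj B f)).
have invK B : cancel (inv B) (@adapted_rep B).
  by move=> f; exact: (projT2 (cid (adapted_rep_surj f))).
have Kinv B : cancel (@adapted_rep B) (inv B).
  by move=> g; apply: adapted_rep_inj; rewrite invK.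
exists; apply: (@Representation _ _ F A L (fun B => @adapted_rep B) inv Kinv invK).
by move=> B B' g f; rewrite /= /adapted_rep fmapM mcompA.
Qed.

(** Since [ladj_rep] picks an unspecified representation, the claim is needed for all of them. It
    follows from uniqueness of the representing object: a and b compare r with the representation by
    L. *)
Lemma adapted_runit_iso (r : representation F A) : is_iso (runit r).
Proof.
have [a aE] := runit_surj r u; have [b bE] := adapted_rep_surj (runit r).
rewrite /adapted_rep in bE; rewrite -bE; apply: iso_comp => //.
exists (fmap F a); rewrite -!fmapM -!fmap1; split; congr (fmap F _).
  by apply: adapted_rep_inj; rewrite /adapted_rep fmapM fmap1 -mcompA bE aE mcomp1m.
by apply: (runit_inj (r := r)); rewrite fmapM fmap1 -mcompA aE bE mcomp1m.
Qed.

End AdaptedRepresentation.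

Section Condition3.
Hypothesis hadj : forall A : C, projective A -> ladj_defined F A.

Let PC := full_sub (@projective C).
Let M : functor PC C := fcomp (fcomp F (ladj F)) (full_sub_incl hadj).
Let unit (A : PC) : mor (sval A) (M A) :=
  runit (ladj_rep (full_sub_incl hadj A)).

Lemma unit_natural (A B : PC) (f : mor (sval A) (sval B)) :
  unit B ∘ f = fmap M (f : mor A B) ∘ unit A.
Proof. by rewrite /= -[RHS]rep_runit rep_invK. Qed.

(* A natural isomorphism F F^ = id makes the unit, read through it, a central
   endomorphism of the identity; it has a left inverse by a triangle identity,
   and centrality makes this inverse two-sided. *)
Lemma unit_iso : nat_iso M (full_incl (@projective C)) ->
  forall A : PC, is_iso (unit A).
Proof.
move=> [theta [thetaI thetaN]] A; have [ti [tiK Kti]] := thetaI A.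
have pM : projective (M A).
  by apply: (@projective_iso _ (sval A) (M A) ti); [exists (theta A)|exact: svalP A].
pose A2 : PC := exist _ (M A) pM.
(* The object M A is projective, so it has a left adjoint too, and c is the counit at the left
   adjoint of A; [cE] is the triangle identity. *)
have [c cE] := runit_surj (ladj_rep (full_sub_incl hadj A2)) (idm (M A)).
pose Mti := fmap M (ti : mor A A2).
pose v : mor (sval A) (sval A) := theta A ∘ fmap F c ∘ Mti ∘ ti.
pose u : mor (sval A) (sval A) := theta A ∘ unit A.
have uC x : u ∘ x = x ∘ u.
  rewrite /u -mcompA unit_natural mcompA.
  by rewrite [theta A ∘ fmap M _](thetaN A A x) -[LHS]mcompA.
have vu : v ∘ u = idm (sval A).
  rewrite /v /u -!mcompA (mcompA ti) tiK mcomp1m.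
  rewrite [Mti ∘ _](_ : _ = unit A2 ∘ ti); last exact/esym/unit_natural.
  by rewrite (mcompA (fmap F c)) [fmap F c ∘ _]cE mcomp1m Kti.
have -> : unit A = ti ∘ u by rewrite /u mcompA tiK mcomp1m.
apply: iso_comp; first by exists (theta A).
by exists v; rewrite uC.
Qed.

Lemma enough_adapted_of_unit : enough_projectives C ->
  nat_iso M (full_incl (@projective C)) -> enough_adapted F.
Proof.
move=> enC iM X; have [A [e [pA ee]]] := enC X; pose A' : PC := exist _ A pA.
have uI := unit_iso iM A'; have [v [vu uv]] := uI.
exists (rep_obj (ladj_rep (full_sub_incl hadj A'))), (e ∘ v); split.
  exact: runit_iso_adapted pA uI.
by apply: epi_comp => //; apply: iso_epi; exists (unit A').
Qed.

Lemma unit_nat_iso : (forall A : PC, is_iso (unit A)) ->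
  nat_iso M (full_incl (@projective C)).
Proof.
move=> uI; apply: nat_iso_sym; exists unit; split=> // A B f.
exact: unit_natural.
Qed.

End Condition3.

Hypotheses (hT : idempotents_split T) (enF : enough_adapted F).

Lemma enough_adapted_projectives : enough_projectives C.
Proof. by move=> A; have [L [e [[pL _ _] ee]]] := enF A; exists (F L), e. Qed.

Lemma adapted_retract (L L' : T) (r : mor L L') (s : mor L' L) :
  r ∘ s = idm L' -> adapted F L -> adapted F L'.
Proof.
move=> rs [pL fuL faL]; split.
- move=> X Y e f ee; have [g eg] := pL _ _ e (f ∘ fmap F r) ee.
  by exists (g ∘ fmap F s); rewrite mcompA eg -mcompA -fmapM rs fmap1 mcompm1.
- move=> B f; have [g gE] := fuL _ (f ∘ fmap F r); exists (g ∘ s).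
  by rewrite fmapM gE -mcompA -fmapM rs fmap1 mcompm1.
- move=> B g Fg0; have /faL gr0 : fmap F (g ∘ r) = 0 by rewrite fmapM Fg0 mcomp0m.
  by rewrite -(mcompm1 g) -rs mcompA gr0 mcomp0m.
Qed.

(** A section s of a cover e of A by F L gives the idempotent s ∘ e, which lifts to x on L.
    Faithfulness makes x idempotent, and splitting it gives a retract of L whose image under F is A
    up to isomorphism. *)
Lemma projective_adapted (A : C) : projective A ->
  exists (L : T) (u : mor A (F L)), adapted F L /\ is_iso u.
Proof.
move=> pA; have [L [e [aL ee]]] := enF A; have [pL fuL faL] := aL.
have [s es] := pA _ _ e (idm A) ee; have [x xE] := fuL _ (s ∘ e).
have xx : x ∘ x = x.
  apply/eqP; rewrite -subr_eq0; apply/eqP/faL.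
  by rewrite fmapB fmapM xE -mcompA (mcompA e) es mcomp1m subrr.
have [L' [r [i [ri ir]]]] := hT xx.
exists L', (fmap F r ∘ s); split; first exact: adapted_retract ri aL.
exists (e ∘ fmap F i); split.
  rewrite -mcompA (mcompA (fmap F i)) -fmapM ir xE -mcompA es mcompm1.
  exact: es.
rewrite -mcompA (mcompA s) -xE -ir -!fmapM -fmap1.
by rewrite -(mcompA i) ri mcompm1 ri.
Qed.

Lemma enough_adapted_adjoint :
  exists hadj : forall A : C, projective A -> ladj_defined F A,
    nat_iso (fcomp (fcomp F (ladj F)) (full_sub_incl hadj))
            (full_incl (@projective C)).
Proof.
have hadj (A : C) (pA : projective A) : ladj_defined F A.
  have [L [u [aL uI]]] := projective_adapted pA.
  exact: adapted_ladj_defined aL uI.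
exists hadj; apply: unit_nat_iso => A.
have [L [u [aL uI]]] := projective_adapted (svalP A).
exact: adapted_runit_iso aL uI _.
Qed.

End PartialAdjoint.

Lemma stable_functor_id (C : stable_additive) : stable_functor (id_functor C).
Proof.
exists (fun A => idm (susp A)); split=> [A|A B f]; first exact: is_iso1.
by rewrite mcompm1 mcomp1m.
Qed.

(** * Transfer from the restricted Yoneda functor to a universal functor *)

Section UniversalAdapted.
Variables (T : triangulated) (I : ideal T) (C : stable_abelian).
Variable F : functor T C.
Hypotheses (uF : universal I F) (hI : homological_ideal I).
Hypothesis enI : enough_ideal_projectives I.

Notation A := (ideal_freyd hI enI).
Notation h := (ideal_yoneda hI enI).

Let shh : stable_homological h.
Proof. by split; [exact: ideal_yoneda_homological|exact: ideal_yoneda_stable]. Qed.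

Let hexact : ideal_exact I h.
Proof. by move=> X Y f If; apply/ideal_yoneda_ker. Qed.

Let uh : universal I h.
Proof.
apply: adapted_universal => //.
- exact: ideal_yoneda_homological.
- by move=> X Y f; apply: (ideal_yoneda_ker hI enI f).1.
- exact: ideal_yoneda_enough.
- exact: ideal_yoneda_stable.
Qed.

Lemma universal_equivalence : exists (H : functor C A) (K : functor A C),
  [/\ exact_functor H, exact_functor K, nat_iso (fcomp H F) h,
      nat_iso (fcomp K H) (id_functor C) & nat_iso (fcomp H K) (id_functor A)].
Proof.
have [shF Fexact extF] := uF; have [_ _ exth] := uh.
have [[H [exH stH HF]] _] := extF _ h shh hexact.
have [[K [exK stK Kh]] _] := exth _ F shF Fexact.
exists H, K; split=> //.
  apply: (extF _ F shF Fexact).2; split.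
  - exact: exact_functor_comp exK exH.
  - exact: stable_functor_comp stK stH.
  - exact: nat_iso_trans (nat_iso_compl K HF) Kh.
  - exact: exact_functor_id.
  - exact: stable_functor_id.
  - exact: nat_iso_refl.
apply: (exth _ h shh hexact).2; split.
- exact: exact_functor_comp exH exK.
- exact: stable_functor_comp stH stK.
- exact: nat_iso_trans (nat_iso_compl H Kh) HF.
- exact: exact_functor_id.
- exact: stable_functor_id.
- exact: nat_iso_refl.
Qed.

Lemma universal_ker : ideal_sub (ker F) I.
Proof.
have [H [K [_ _ HF _ _]]] := universal_equivalence.
move=> X Y f Ff0; apply/(ideal_yoneda_ker hI enI).
apply: (nat_iso_fmap0 HF); rewrite /= (_ : fmap F f = 0) //.
exact: (fmap0 H).
Qed.

Lemma universal_enough_adapted : enough_adapted F.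
Proof.
have [H [K [exH exK HF KH HK]]] := universal_equivalence.
have Hfu := equivalence_full KH HK; have Hfa := nat_iso_id_faithful KH.
have abC := stable_is_abelian C; have abA := stable_is_abelian A.
have [eta [etaI etaN]] := HF.
(* Projectivity is pulled back along H: it preserves epimorphisms, and its fullness and faithfulness
   bring the lift back to C. *)
have aF L : adapted h L -> adapted F L.
  move=> [pL fuL faL]; have [inv [inveta etainv]] := etaI L; split.
  - move=> X Y e f ee; have He := exact_functor_epi abC exH ee.
    have pHL : projective (H (F L)).
      by apply: (projective_iso _ pL); exists (eta L); split; [exact: etainv|exact: inveta].
    have [g] := pHL _ _ _ (fmap H f) He; have [g' <-] := Hfu _ _ g.
    by rewrite -fmapM => /(faithful_inj Hfa) eg; exists g'.
  - move=> B f; have [g hg] := fuL B (eta B ∘ fmap H f ∘ inv); exists g.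
    apply: (faithful_inj Hfa); have [inv' [inv'eta _]] := etaI B.
    rewrite -[LHS]mcomp1m -inv'eta -[LHS]mcompA [X in inv' ∘ X]etaN hg.
    rewrite -!mcompA inveta mcompm1 mcompA inv'eta.
    exact: mcomp1m.
  - move=> B g Fg0; apply: faL; apply: (nat_iso_fmap0 HF).
    by rewrite /= Fg0; exact: (fmap0 H).
move=> X; have [L [e [aL ee]]] := ideal_yoneda_enough (H X : A).
(* A cover of H X comes from a morphism of C by fullness, and faithful functors reflect
   epimorphisms. *)
have [y yE] := Hfu _ _ (e ∘ eta L).
exists L, y; split; first exact: aF.
move=> Z a b ab; apply: (faithful_inj Hfa).
apply: (@epi_comp _ _ _ _ e (eta L) ee (iso_epi (etaI L))).
by rewrite -yE -[LHS](fmapM H) -[RHS](fmapM H) ab.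
Qed.

End UniversalAdapted.

Theorem theorem3p39 (T : triangulated) (I : ideal T) (C : stable_abelian)
    (F : functor T C)
    (hI : homological_ideal I) (hF : stable_homological F)
    (hFI : ideal_exact I F) (hT : idempotents_split T) :
  universal I F /\ enough_ideal_projectives I <->
  ideal_sub (ker F) I /\
  enough_projectives C /\
  exists hadj : forall A : C, projective A -> ladj_defined F A,
    nat_iso (fcomp (fcomp F (ladj F)) (full_sub_incl hadj))
            (full_incl (@projective C)).
Proof.
split=> [[uF enI]|[kerF [enC [hadj iM]]]].
  have enF := universal_enough_adapted uF hI enI.
  split; first exact: universal_ker uF hI enI.
  split; first exact: enough_adapted_projectives enF.
  exact: enough_adapted_adjoint hT enF.
have enF := enough_adapted_of_unit enC iM; have [homF stF] := hF.
split; first exact: adapted_universal.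
by apply: (adapted_enough_ideal_projectives (F := F)).
Qed.
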